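(* Let $f:(0,1)\to[0,\infty)$ be of class $C^1(0,1)$ and such that, for every $0<x<1$, $x f'(x)=(1-x)f'(1-x)$ and $f'(x)<0$. Let $\theta_0\in(0,1)$ and let $\pi$ be a prior such that $\pi(\theta_0-\eta,\theta_0+\eta)>0$ for every $\eta>0$. Let $V_f(\hat\theta_n)$ denote the variance of the distribution $\pi_f^{(n)}$. Then $$\lim_{n\to\infty}n\,V_f(\hat\theta_n)=-\frac{\theta_0(1-\theta_0)}{\theta_0\,f'(\theta_0)},\qquad P_{\theta_0}\text{-a.s.}$$
   Context: For $\theta_0\in(0,1)$, under $P_{\theta_0}$ the sequence $(X_n)_{n\ge1}$ consists of i.i.d. $\{0,1\}$-valued random variables with $P_{\theta_0}(X_n=1)=\theta_0$, and $\hat\theta_n=\frac1n\sum_{i=1}^nX_i$. A prior $\pi$ is a probability measure on the Borel subsets of $(0,1)$; throughout, priors are absolutely continuous with respect to Lebesgue measure with a density that is continuous on $(0,1)$. $\pi_f^{(n)}$ is the (random) probability measure on $(0,1)$ that is absolutely continuous with respect to $\pi$ with density $$t\mapsto\frac{e^{-n\{\hat\theta_n f(t)+(1-\hat\theta_n)f(1-t)\}}}{\int_{(0,1)}e^{-n\{\hat\theta_n f(s)+(1-\hat\theta_n)f(1-s)\}}\,\pi(\mathrm{d}s)}.$$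
   Formalization: The prior's continuous density is additionally assumed positive at θ0; without this the claim fails, e.g. θ0=1/2, f=-ln x, density 12(t-1/2)^2, where n V_f tends to 3/4 rather than 1/4 along the infinitely many n with empirical mean 1/2. *)

(* Defs.v *)
From HB Require Import structures.
From mathcomp Require Import all_boot all_order all_algebra.
From mathcomp Require Import all_classical all_reals all_analysis.
From mathcomp Require Import measurable_realfun.

Set Implicit Arguments.
Unset Strict Implicit.
Unset Printing Implicit Defensive.

Import Order.TTheory GRing.Theory Num.Theory.
Import numFieldNormedType.Exports.

Local Open Scope classical_set_scope.
Local Open Scope ring_scope.

Definition mutually_independent (d : measure_display) (T : measurableType d)
    (R : realType) (P : probability T R) (X : nat -> T -> R) : Prop :=
  forall (J : seq nat) (B : nat -> set R), uniq J ->
    (forall i, measurable (B i)) ->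
    P (\bigcap_(i in [set` J]) (X i @^-1` B i)) =
    (\prod_(i <- J) P (X i @^-1` B i))%E.

(* The sequence is indexed from 0: [X i] is the (i+1)-st observation. *)
Definition iid_bernoulli (d : measure_display) (T : measurableType d)
    (R : realType) (P : probability T R) (theta : R)
    (X : nat -> {RV P >-> R}) : Prop :=
  [/\ forall i w, X i w = 0 \/ X i w = 1,
      forall i, P (X i @^-1` [set 1]) = theta%:E
    & mutually_independent P (fun i => X i : T -> R)].

Definition empirical_freq (T : Type) (R : realType) (X : nat -> T -> R)
    (n : nat) (w : T) : R :=
  (\sum_(i < n) X i w) / n%:R.

(* Functions on (0,1) are total functions on R of which only the values on the
   open interval matter; likewise, a probability measure on the Borel subsets of
   (0,1) is a probability measure on R that does not charge the complement. *)

Definition C1_01 (R : realType) (f : R -> R) : Prop :=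
  forall x : R, 0 < x < 1 -> derivable f x 1 /\ {for x, continuous f^`()%classic}.

(* [Q] lives on (0,1) and has density [g] with respect to [mu] there. *)
Definition has_density_01 (R : realType)
    (mu : {measure set (measurableTypeR R) -> \bar R}) (g : R -> R)
    (Q : probability (measurableTypeR R) R) : Prop :=
  forall A : set R, measurable A ->
    Q A = (\int[mu]_(t in A `&` `]0%R, 1%R[) (g t)%:E)%E.

Definition is_prior (R : realType) (nu : probability (measurableTypeR R) R)
    (p : R -> R) : Prop :=
  [/\ forall t : R, 0 < t < 1 -> 0 <= p t,
      forall t : R, 0 < t < 1 -> {for t, continuous p}
    & has_density_01 lebesgue_measure p nu].

Definition gibbs_weight (R : realType) (f : R -> R) (n : nat) (theta t : R) : R :=
  expR (- n%:R * (theta * f t + (1 - theta) * f (1 - t))).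

Definition gibbs_density (R : realType) (f : R -> R)
    (nu : probability (measurableTypeR R) R) (n : nat) (theta t : R) : R :=
  gibbs_weight f n theta t /
  \int[nu]_(s in `]0, 1[) gibbs_weight f n theta s.

(* The probability measure with density [gibbs_density] with respect to [nu];
   [gibbs_posteriorP] shows that the description is satisfied.  Two such
   measures agree on measurable sets, so the choice made by [get] is immaterial. *)
Definition gibbs_posterior (R : realType) (f : R -> R)
    (nu : probability (measurableTypeR R) R) (n : nat) (theta : R) :
    probability (measurableTypeR R) R :=
  get [set Q | has_density_01 nu (gibbs_density f nu n theta) Q].

Section density_probability.
Context {R : realType} (nu : probability (measurableTypeR R) R) (g : R -> R).
Hypothesis mg : measurable_fun (`]0, 1[ : set (measurableTypeR R)) g.
Hypothesis g0 : forall t : R, 0 < t < 1 -> 0 <= g t.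
Hypothesis g1 : (\int[nu]_(t in `]0%R, 1%R[) (g t)%:E = 1)%E.

Definition density_fun (t : measurableTypeR R) : R := (g \_ `]0, 1[) t.

Let h0 t : 0 <= density_fun t.
Proof.
rewrite /density_fun patchE; case: ifPn => //.
by rewrite inE/= in_itv/=; exact: g0.
Qed.

Let mh : measurable_fun setT density_fun.
Proof. by apply/(measurable_restrictT _ _).1. Qed.

Definition density_measure (A : set (measurableTypeR R)) : \bar R :=
  (\int[nu]_(t in A) (density_fun t)%:E)%E.

Let Q0 : density_measure set0 = 0%E.
Proof. by rewrite /density_measure integral_set0. Qed.

Let Q_ge0 A : (0 <= density_measure A)%E.
Proof. by apply: integral_ge0 => t _; rewrite lee_fin. Qed.

Let Q_sigma_additive : semi_sigma_additive density_measure.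
Proof.
move=> F mF tF mUF; rewrite /density_measure; apply: cvg_toP.
  apply: ereal_nondecreasing_is_cvgn => m n mn.
  by apply: lee_sum_nneg_natr => // k _ _; exact: Q_ge0.
rewrite ge0_integral_bigcup//=.
- by apply/measurable_EFinP; exact: measurable_funTS.
- by move=> t _; rewrite lee_fin.
Qed.

HB.instance Definition _ := isMeasure.Build _ _ _ density_measure
  Q0 Q_ge0 Q_sigma_additive.

Let QE A :
  density_measure A = (\int[nu]_(t in A `&` `]0%R, 1%R[) (g t)%:E)%E.
Proof.
rewrite /density_measure integral_mkcondr.
by apply: eq_integral => t _; rewrite restrict_EFin.
Qed.

Let QT : density_measure [set: _] = 1%E. Proof. by rewrite QE setTI. Qed.

HB.instance Definition _ :=
  Measure_isProbability.Build _ _ _ density_measure QT.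

Lemma ex_has_density_01 : exists Q, has_density_01 nu g Q.
Proof. by exists density_measure => A mA; exact: QE. Qed.

End density_probability.

Lemma C1_01_measurable (R : realType) (f : R -> R) :
  C1_01 f -> measurable_fun (`]0, 1[ : set (measurableTypeR R)) f.
Proof.
move=> fC1; apply: open_continuous_measurable_fun; first exact: interval_open.
move=> x; rewrite inE/= in_itv/= => x01.
by have [/derivable1_diffP/differentiable_continuous] := fC1 x x01.
Qed.

Lemma gibbs_posteriorP (R : realType) (f : R -> R)
    (nu : probability (measurableTypeR R) R) (n : nat) (theta : R) :
  measurable_fun (`]0, 1[ : set (measurableTypeR R)) f ->
  (forall x : R, 0 < x < 1 -> 0 <= f x) ->
  nu `]0%R, 1%R[%classic = 1%E -> 0 <= theta <= 1 ->
  has_density_01 nu (gibbs_density f nu n theta) (gibbs_posterior f nu n theta).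
Proof.
move=> mf f0 nu1 /andP[theta0 theta1].
set w := gibbs_weight f n theta.
have mw : measurable_fun (`]0, 1[ : set (measurableTypeR R)) w.
  apply: measurableT_comp => //; apply: measurable_funM => //.
  apply: measurable_funD; apply: measurable_funM => //.
  apply: (@measurable_comp _ _ _ _ _ _ (`]0, 1[ : set (measurableTypeR R))) => //.
    move=> _ [t + <-]; rewrite /= !in_itv/= => /andP[t0 t1].
    by rewrite subr_gt0 t1 ltrBlDr ltrDl.
  by apply: measurable_funB.
have w0 t : 0 < w t by exact: expR_gt0.
have w1 t : 0 < t < 1 -> w t <= 1.
  move=> /andP[t0 t1]; rewrite -expR0 ler_expR mulNr oppr_le0 mulr_ge0//.
  rewrite addr_ge0// mulr_ge0 ?subr_ge0//; apply: f0; first by rewrite t0.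
  by rewrite subr_gt0 t1 ltrBlDr ltrDl.
have intE : (\int[nu]_(t in `]0%R, 1%R[) (w t)%:E <= 1)%E.
  rewrite -nu1 -[leRHS]mul1e -integral_cst//; apply: ge0_le_integral => //.
  - by move=> t _; rewrite lee_fin ltW.
  - exact/measurable_EFinP.
have int0 : (0 < \int[nu]_(t in `]0%R, 1%R[) (w t)%:E)%E.
  rewrite lt_neqAle integral_ge0 ?andbT; last first.
    by move=> t _; rewrite lee_fin ltW.
  apply/eqP => int0.
  have : (\int[nu]_(t in `]0%R, 1%R[) `|(w t)%:E| = 0)%E.
    rewrite [RHS]int0; apply: eq_integral => t _.
    by rewrite gee0_abs// lee_fin ltW.
  move/ae_eq_integral_abs => /(_ (measurable_itv _)) H.
  have {H}[|N [mN N0 sub]] := H; first exact/measurable_EFinP.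
  have : (nu `]0%R, 1%R[%classic <= nu N)%E.
    apply: le_measure; rewrite ?inE//; apply: subset_trans sub.
    by move=> t t01 /= /(_ t01) /eqP; rewrite eqe gt_eqF.
  by rewrite [leRHS]N0 [leLHS]nu1 leNgt lte01.
have fin : (\int[nu]_(t in `]0%R, 1%R[) (w t)%:E)%E \is a fin_num.
  by rewrite ge0_fin_numE ?(le_lt_trans intE) ?ltry// ltW.
set Z := \int[nu]_(s in `]0, 1[) w s.
have ZE : (Z%:E = \int[nu]_(t in `]0%R, 1%R[) (w t)%:E)%E by rewrite /Z fineK.
have Z0 : 0 < Z by rewrite -lte_fin ZE.
rewrite /gibbs_posterior; apply: (@getPex _ (has_density_01 _ _)).
apply: ex_has_density_01.
- exact: measurable_funM.
- by move=> t _; rewrite divr_ge0// ltW.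
- rewrite /gibbs_density -/w -/Z.
  under eq_integral do rewrite EFinM muleC.
  rewrite ge0_integralZl//.
  + by rewrite -ZE -EFinM mulVf// gt_eqF.
  + exact/measurable_EFinP.
  + by move=> t _; rewrite lee_fin ltW.
  + by rewrite lee_fin invr_ge0 ltW.
Qed.

(* Main.v *)
Require Import Defs.
From HB Require Import structures.
From mathcomp Require Import all_boot all_order all_algebra.
From mathcomp Require Import all_classical all_reals all_analysis.
From mathcomp Require Import measurable_realfun.
From mathcomp Require Import ring lra zify.

Set Implicit Arguments.
Unset Strict Implicit.
Unset Printing Implicit Defensive.

Import Order.TTheory GRing.Theory Num.Theory.
Import numFieldNormedType.Exports.

Local Open Scope classical_set_scope.
Local Open Scope ring_scope.

(** Let g(t) = - f'(t) / (1 - t) and let L(q, t) = q f(t) + (1 - q) f(1 - t).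
    The symmetry of f' turns the derivative of the loss into
    dL/dt (q, t) = g(t) (t - q) with g > 0, so that L(q, .) decreases up to q and
    increases afterwards, with curvature g(q) at its minimum: the posterior
    should look like a normal law with mean q and variance 1 / (n g(q)).  Since
    the empirical frequencies q_n converge almost surely to theta0
    ([bernoulli_slln]), the limit is 1 / g(theta0), provided that the density
    p of the prior does not vanish at theta0.

    No Gaussian integral has to be computed.  Let w(t) = exp (- n L(q, t)) be the
    Gibbs weight, so that w' = - n (t - q) g w.  Integrating the derivatives of
    w and of (t - q) w over a segment [a, b] around theta0 gives the exact
    identities
      n int (t - q) g w = w(a) - w(b),
      n int (t - q)^2 g w = int w - [(t - q) w]_a^b.
    Let S be the integral of w over [a, b].  By monotonicity of the loss, n w / S
    tends to 0 uniformly away from theta0 ([gibbs_weight_off]), so the boundary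
    terms are negligible.  Hence the three kernels w / S, sqrt n (t - q) g w / S
    and n (t - q)^2 g w / S concentrate at theta0 with total masses tending to
    1, 0 and 1; integrating p or p / g against them ([approximate_identity])
    gives the limits p(theta0), 0 and p(theta0) / g(theta0) of the rescaled
    moments of orders 0, 1 and 2 ([laplace_moment0], [laplace_moment1],
    [laplace_moment2]).  What lies outside [a, b] is negligible for the same
    reason, and n times the variance is m2 / m0 - (m1 / m0)^2, where the mj are
    these moments ([posterior_momentE], [gibbs_posterior_variance_cvg]). *)

(** * Almost sure convergence from summable integrals *)

Lemma integrable_bounded (d : measure_display) (T : measurableType d)
    (R : realType) (mu : {measure set T -> \bar R}) (D : set T) (M : R)
    (h : T -> R) : measurable D -> (mu D < +oo)%E -> measurable_fun D h ->
  (forall t, D t -> `|h t| <= M) -> mu.-integrable D (EFin \o h).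
Proof.
move=> mD Doo mh hM; apply: measurable_bounded_integrable => //.
exists M; split; first exact: num_real.
by move=> K MK t Dt; exact: le_trans (hM t Dt) (ltW MK).
Qed.

(** The sum of the series has a finite integral, hence is finite almost
    everywhere, and the terms of a convergent series tend to 0. *)
Lemma ae_cvg0_of_summable_integral (d : measure_display) (T : measurableType d)
    (R : realType) (mu : {measure set T -> \bar R}) (Z : nat -> T -> R) :
  (forall n, measurable_fun setT (Z n)) -> (forall n t, 0 <= Z n t) ->
  (\sum_(n <oo) \int[mu]_t (Z n t)%:E < +oo)%E ->
  {ae mu, forall t, Z n t @[n --> \oo] --> 0}.
Proof.
move=> mZ Z0 Zoo.
have mZE n : measurable_fun setT (fun t => (Z n t)%:E).
  exact/measurable_EFinP.
have : mu.-integrable setT (fun t => \sum_(n <oo) (Z n t)%:E)%E.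
  apply/integrableP; split.
    apply: ge0_emeasurable_sum => //.
    by move=> n t _ _; rewrite lee_fin.
  rewrite (eq_integral (fun t => \sum_(n <oo) (Z n t)%:E)%E); last first.
    by move=> t _; rewrite gee0_abs// nneseries_ge0// => n _ _; rewrite lee_fin.
  by rewrite integral_nneseries// => n t _; rewrite lee_fin.
move=> /(integrable_ae measurableT); apply: filterS => t /(_ I) fint.
apply: (@cvg_series_cvg_0 _ R^o); apply: nnseries_is_cvg => //.
by move: fint; rewrite ge0_fin_numE// nneseries_ge0// => n _ _; rewrite lee_fin.
Qed.

(** The partial sums of 1 / k^2 up to n are at most 2 - 1 / n, by telescoping. *)
Lemma nneseries_inv_sqr_lty (R : realType) :
  (\sum_(k <oo) ((k.+1%:R ^+ 2)^-1 : R)%:E < +oo)%E.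
Proof.
apply: (@le_lt_trans _ _ 2%:E); last exact: ltry.
apply: lime_le.
  by apply: is_cvg_nneseries => n _ _; rewrite lee_fin invr_ge0 exprn_ge0.
apply: nearW => -[|n]; rewrite sumEFin lee_fin; first by rewrite big_geq.
suff: \sum_(0 <= k < n.+1) ((k.+1%:R ^+ 2)^-1 : R) <= 2 - n.+1%:R^-1.
  by move=> /le_trans; apply; rewrite gerBl.
elim: n => [|n IH]; first by rewrite big_nat1 expr1n invr1; lra.
rewrite big_nat_recr//=; apply: (le_trans (lerD IH (lexx _))).
have n0 : (0 : R) < n.+1%:R by rewrite ltr0n.
rewrite -[n.+2%:R]natr1; move: n.+1%:R n0 => {IH} x x0.
have x1 : 0 < x + 1 by rewrite ltr_wpDl// ltW.
have -> : 2 - x^-1 + ((x + 1) ^+ 2)^-1 =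
    2 - (x + 1)^-1 - (x * (x + 1) ^+ 2)^-1.
  by field; rewrite !gt_eqF.
by rewrite gerBl invr_ge0 mulr_ge0 ?exprn_ge0// ltW.
Qed.

(** * The strong law of large numbers for Bernoulli variables *)

Section bernoulli_slln.
Context (d : measure_display) (T : measurableType d) (R : realType).
Context (P : probability T R) (theta : R) (X : nat -> {RV P >-> R}).
Hypothesis iidX : iid_bernoulli theta X.

Let X01 i w : X i w = 0 \/ X i w = 1. Proof. by case: iidX. Qed.

Let mX1 i : measurable (X i @^-1` [set 1%R]).
Proof. by rewrite -[_ @^-1` _]setTI; exact: measurable_funP. Qed.

Lemma bernoulli_param_itv : 0 <= theta <= 1.
Proof.
case: iidX => _ /(_ 0%N) X1 _.
by rewrite -!lee_fin -X1 measure_ge0 probability_le1.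
Qed.

Let theta0 : 0 <= theta. Proof. by case/andP: bernoulli_param_itv. Qed.
Let theta1 : theta <= 1. Proof. by case/andP: bernoulli_param_itv. Qed.

Lemma Rintegral_bernoulli i : \int[P]_w X i w = theta.
Proof.
have XE w : X i w = \1_(X i @^-1` [set 1]) w.
  rewrite indicE; have [Xw|Xw] := X01 i w; rewrite Xw.
    by rewrite memNset//= Xw => /eqP; rewrite eq_sym oner_eq0.
  by rewrite mem_set.
under eq_Rintegral do rewrite XE.
rewrite /Rintegral integral_indic// setIT.
by case: iidX => _ /(_ i) X1 _; exact: (congr1 fine X1).
Qed.

Lemma Rintegral_bernoulliM i j : i != j -> \int[P]_w (X i w * X j w) = theta ^+ 2.
Proof.
move=> ij.
have XE w : X i w * X j w = \1_(X i @^-1` [set 1] `&` X j @^-1` [set 1]) w.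
  rewrite indicE in_setI.
  have [Xw|Xw] := X01 i w; rewrite Xw ?mul0r ?mul1r.
    by rewrite memNset//= Xw => /eqP; rewrite eq_sym oner_eq0.
  rewrite mem_set//=; have [Xw'|Xw'] := X01 j w; rewrite Xw'.
    by rewrite memNset//= Xw' => /eqP; rewrite eq_sym oner_eq0.
  by rewrite mem_set.
under eq_Rintegral do rewrite XE.
rewrite /Rintegral integral_indic//; last exact: measurableI.
rewrite setIT; case: iidX => _ X1 /(_ [:: i; j] (fun=> [set 1])).
rewrite /= inE ij /= => /(_ erefl (fun=> measurable_set1 _)).
rewrite big_cons big_seq1 !X1 => Xij.
have -> : X i @^-1` [set 1] `&` X j @^-1` [set 1] =
    \bigcap_(k in [set` [:: i; j]]) (X k @^-1` [set 1]).
  apply/seteqP; split => [w [Xi Xj] k|w /= Xw].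
    by rewrite /= !inE => /orP[] /eqP ->.
  by split; apply: Xw; rewrite /= !inE eqxx ?orbT.
by rewrite expr2; exact: (congr1 fine Xij).
Qed.

Let Y i w := X i w - theta.
Definition centered_sum (n : nat) (w : T) : R :=
  \sum_(i < n) (X i w - theta).

Local Notation U := centered_sum.

Let mY i : measurable_fun setT (Y i).
Proof. by apply: measurable_funB. Qed.

Let Y1 i w : `|Y i w| <= 1.
Proof.
have := theta1; have := theta0; rewrite ler_norml /Y.
by have [->|->] := X01 i w; lra.
Qed.

Let US n w : U n.+1 w = U n w + Y n w.
Proof. by rewrite /U big_ord_recr. Qed.

Let mU n : measurable_fun setT (U n).
Proof. by apply: measurable_sum => i; exact: mY. Qed.

Let Un n w : `|U n w| <= n%:R.
Proof.
rewrite (le_trans (ler_norm_sum _ _ _))// -[in leRHS](card_ord n) -sumr_const.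
by apply: ler_sum => i _; exact: Y1.
Qed.

Let intP (M : R) (h : T -> R) : measurable_fun setT h ->
  (forall t, `|h t| <= M) -> P.-integrable setT (EFin \o h).
Proof.
move=> mh hM; apply: (@integrable_bounded _ _ _ _ _ M) => //.
by rewrite ltey_eq fin_num_measure.
Qed.

Let Rintegral_cstP (r : R) : \int[P]_(w in setT) r = r.
Proof.
by rewrite Rintegral_cst// [X in fine X](probability_setT P) mulr1.
Qed.

Let Rintegral_YY i j : i != j -> \int[P]_w (Y i w * Y j w) = 0.
Proof.
move=> ij; have X1 k w : `|X k w| <= 1.
  by have [->|->] := X01 k w; rewrite ?normr0 ?normr1.
have YYE w : Y i w * Y j w =
    X i w * X j w - (theta * X i w + (theta * X j w - theta ^+ 2)).
  by rewrite /Y; ring.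
under eq_Rintegral do rewrite YYE.
have iX k : P.-integrable setT (EFin \o X k) by exact: (intP (M := 1)).
have iZX k : P.-integrable setT (EFin \o (fun w => theta * X k w)).
  apply: (intP (M := 1)); first exact: measurable_funM.
  by move=> w; rewrite normrM mulr_ile1// ger0_norm.
have iXB : P.-integrable setT (EFin \o (fun w => theta * X j w - theta ^+ 2)).
  apply: (intP (M := 2)).
    by apply: measurable_funB => //; exact: measurable_funM.
  move=> w; rewrite (le_trans (ler_normB _ _))// -[leRHS]/(1 + 1) lerD//.
    by rewrite normrM mulr_ile1// ger0_norm.
  by rewrite ger0_norm ?exprn_ge0// expr2 mulr_ile1.
rewrite RintegralB//=; last 2 first.
- apply: (intP (M := 1)); first exact: measurable_funM.
  by move=> w; rewrite normrM mulr_ile1.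
- apply: (intP (M := 3)).
    apply: measurable_funD; first exact: measurable_funM.
    by apply: measurable_funB => //; exact: measurable_funM.
  move=> w; have [->|->] := X01 i w; have [->|->] := X01 j w;
  by rewrite ler_norml; have := theta1; have := theta0; nra.
rewrite RintegralD// RintegralB//; last first.
  by apply: (intP (M := `|theta ^+ 2|)) => //; exact: measurable_cst.
rewrite Rintegral_cstP !RintegralZl// Rintegral_bernoulliM//.
by rewrite !Rintegral_bernoulli; ring.
Qed.

(* Pairwise orthogonality, summed up: a centred partial sum is orthogonal to
   every later centred variable. *)
Let Rintegral_UY m n : (m <= n)%N -> \int[P]_w (U m w * Y n w) = 0.
Proof.
elim: m => [_|m IH mn].
  under eq_Rintegral do rewrite /U big_ord0 mul0r.
  by rewrite Rintegral_cstP.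
under eq_Rintegral do rewrite US mulrDl.
rewrite RintegralD//=.
- by rewrite IH 1?ltnW// Rintegral_YY ?addr0// neq_ltn mn.
- apply: (intP (M := m%:R)); first exact: measurable_funM.
  by move=> w; rewrite normrM -[leRHS]mulr1 ler_pM.
- apply: (intP (M := 1)); first exact: measurable_funM.
  by move=> w; rewrite normrM mulr_ile1.
Qed.

Lemma Rintegral_centered_sum_sqr_le n : \int[P]_w U n w ^+ 2 <= n%:R.
Proof.
elim: n => [|n IH].
  under eq_Rintegral do rewrite /U big_ord0 expr0n/=.
  by rewrite Rintegral_cstP.
have UE w : U n.+1 w ^+ 2 = U n w ^+ 2 + (2 * (U n w * Y n w) + Y n w ^+ 2).
  by rewrite US; ring.
under eq_Rintegral do rewrite UE.
have mUY : measurable_fun setT (fun w => U n w * Y n w) by exact: measurable_funM.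
have UY w : `|U n w * Y n w| <= n%:R by rewrite normrM -[leRHS]mulr1 ler_pM.
have iUY : P.-integrable setT (EFin \o (fun w => U n w * Y n w)).
  exact: intP UY.
have iZUY : P.-integrable setT (EFin \o (fun w => 2 * (U n w * Y n w))).
  apply: (intP (M := 2 * n%:R)); first exact: measurable_funM.
  by move=> w; rewrite normrM ger0_norm// ler_pM2l.
have mYY : measurable_fun setT (fun w => Y n w ^+ 2) by exact: measurable_funX.
have YY w : `|Y n w ^+ 2| <= 1 by rewrite normrX expr_le1.
have iYY : P.-integrable setT (EFin \o (fun w => Y n w ^+ 2)) by exact: intP YY.
rewrite RintegralD//=; last 2 first.
- apply: (intP (M := n%:R ^+ 2)); first exact: measurable_funX.
  by move=> w; rewrite normrX lerXn2r ?nnegrE.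
- apply: (intP (M := 2 * n%:R + 1)).
    by apply: measurable_funD => //; exact: measurable_funM.
  move=> w; rewrite (le_trans (ler_normD _ _))// lerD//.
  by rewrite normrM ger0_norm// ler_pM2l.
rewrite -[leRHS]natr1 lerD// RintegralD// RintegralZl// Rintegral_UY// mulr0 add0r.
rewrite (@le_trans _ _ (\int[P]_(w in setT) 1))//; last first.
  by rewrite Rintegral_cstP.
apply: le_Rintegral => //.
- by apply: (intP (M := 1)) => // w; rewrite normr1.
- by move=> w _; rewrite (le_trans (ler_norm _)).
Qed.

(** Along the squares the second moments of the empirical deviations are at most
    1 / n^2, hence summable. *)
Lemma ae_cvg_sqr_subsequence :
  {ae P, forall w, U (n.+1 ^ 2) w / (n.+1 ^ 2)%:R @[n --> \oo] --> 0}.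
Proof.
have : {ae P, forall w, (U (n.+1 ^ 2) w / (n.+1 ^ 2)%:R) ^+ 2 @[n --> \oo] --> 0}.
  apply: ae_cvg0_of_summable_integral.
  - by move=> n; apply: measurable_funX; exact: measurable_funM.
  - by move=> n w; rewrite sqr_ge0.
  apply: le_lt_trans (nneseries_inv_sqr_lty R); apply: lee_nneseries => [n _ _|n _].
    by apply: integral_ge0 => w _; rewrite lee_fin sqr_ge0.
  set N := (n.+1 ^ 2)%N.
  have N0 : (0 : R) < N%:R by rewrite ltr0n expn_gt0.
  have iU : P.-integrable setT (EFin \o (fun w => U N w ^+ 2)).
    apply: (intP (M := N%:R ^+ 2)); first exact: measurable_funX.
    by move=> w; rewrite normrX lerXn2r ?nnegrE.
  have -> : (\int[P]_w ((U N w / N%:R) ^+ 2)%:E =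
             (\int[P]_w ((N%:R ^+ 2)^-1 * U N w ^+ 2))%:E)%E.
    rewrite /Rintegral fineK.
      by apply: eq_integral => w _; rewrite exprMn exprVn mulrC.
    apply: integrable_fin_num => //.
    apply: (intP (M := 1)).
      by apply: measurable_funM => //; exact: measurable_funX.
    move=> w; rewrite normrM normrX gtr0_norm ?invr_gt0 ?exprn_gt0//.
    by rewrite ler_pdivrMl ?exprn_gt0// mulr1 lerXn2r ?nnegrE.
  rewrite RintegralZl// lee_fin ler_pdivrMl ?exprn_gt0//.
  apply: (le_trans (Rintegral_centered_sum_sqr_le N)).
  by rewrite -[n.+1%:R ^+ 2]natrX -/N [N%:R ^+ 2]expr2 mulfK// gt_eqF.
apply: filterS => w Uw.
apply/cvgr0Pnorm_le => e e0.
move/cvgr0Pnorm_le : Uw => /(_ (e ^+ 2)); rewrite exprn_gt0// => /(_ erefl).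
by apply: filterS => n; rewrite normrX ler_pXn2r// nnegrE ltW.
Qed.

(** Convergence along the squares suffices, because the centred sums are
    1-Lipschitz in n: if k^2 <= n <= k^2 + 2 k, passing from k^2 to n changes the
    average by at most 2 / k. *)
Lemma bernoulli_slln :
  {ae P, forall w,
    empirical_freq (fun i => X i : T -> R) n w @[n --> \oo] --> theta}.
Proof.
apply: filterS ae_cvg_sqr_subsequence => w Uw.
have lip m k : `|U (m + k)%N w| <= `|U m w| + k%:R.
  elim: k => [|k IH]; first by rewrite addn0 addr0.
  rewrite addnS US (le_trans (ler_normD (U _ w) (Y _ w)))// -natr1 addrA.
  exact: lerD.
apply/cvgrPdist_le => e e0.
have e2 : 0 < e / 2 by rewrite divr_gt0.
have [K _ KU] : \forall n \near \oo, `|U (n.+1 ^ 2) w / (n.+1 ^ 2)%:R| <= e / 2.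
  by move/cvgr0Pnorm_le : Uw => /(_ _ e2).
have [K' _ K'e] : \forall n \near \oo, (2 * n.+1%:R^-1 : R) <= e / 2.
  have e4 : 0 < e / 4 by rewrite divr_gt0.
  have /cvgr0Pnorm_le/(_ _ e4) := @cvg_harmonic R.
  apply: filterS => n; rewrite ger0_norm ?invr_ge0// => ne.
  by rewrite mulrC -ler_pdivlMr// (le_trans ne)//; lra.
(* With this bound on n the integer square root k exceeds both K and K'. *)
exists ((maxn K K').+2 ^ 2)%N => // n /= Kn.
have [k kn nk] : exists2 k, (k ^ 2 <= n)%N & (n <= k ^ 2 + k.*2)%N.
  elim: {Kn} n => [|n [k kn nk]]; first by exists 0%N.
  have [nk1|nk1] := leqP n.+1 (k ^ 2 + k.*2).
    by exists k => //; lia.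
  by exists k.+1; nia.
have kK : (maxn K K' < k)%N.
  by rewrite ltnNge; apply/negP => kK; move: Kn; apply/negP; rewrite -ltnNge; nia.
case: k kK kn nk => // k kK kn nk.
have k0 : (0 : R) < (k.+1 ^ 2)%:R by rewrite ltr0n expn_gt0.
have n0 : (0 : R) < n%:R by rewrite (lt_le_trans k0)// ler_nat.
have -> : theta - empirical_freq (fun i => X i : T -> R) n w = - (U n w / n%:R).
  rewrite /empirical_freq /U sumrB sumr_const card_ord.
  by rewrite mulrBl -[theta *+ n]mulr_natr mulfK ?gt_eqF// opprB.
rewrite normrN normrM [`|n%:R^-1|]gtr0_norm ?invr_gt0//.
apply: (@le_trans _ _ (`|U n w| / (k.+1 ^ 2)%:R)).
  by rewrite ler_wpM2l// lef_pV2 ?posrE// ler_nat.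
apply: (@le_trans _ _ ((`|U (k.+1 ^ 2) w| + k.+1.*2%:R) / (k.+1 ^ 2)%:R)).
  rewrite ler_pM2r ?invr_gt0// -(subnKC kn) (le_trans (lip _ _))// lerD2l ler_nat.
  lia.
rewrite mulrDl (splitr e) lerD//.
  have := KU k; rewrite /= normrM [`|_^-1|]gtr0_norm ?invr_gt0//; apply.
  by rewrite (leq_trans (leq_maxl K K')).
have -> : k.+1.*2%:R / (k.+1 ^ 2)%:R = 2 * k.+1%:R^-1 :> R.
  by rewrite natrX -mul2n natrM expr2 invfM mulrA mulfK// pnatr_eq0.
by apply: K'e; rewrite /= (leq_trans (leq_maxr K K')).
Qed.

End bernoulli_slln.

(** * Probability measures with a density on the unit interval *)

(** [g] agrees almost everywhere with the Radon-Nikodym derivative of [Q], for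
    which the change of variables is known. *)
Lemma integral_has_density_01 (R : realType)
    (mu : {sigma_finite_measure set (measurableTypeR R) -> \bar R})
    (Q : probability (measurableTypeR R) R) (g h : R -> R)
    (E : set (measurableTypeR R)) :
  has_density_01 mu g Q ->
  measurable_fun (`]0, 1[ : set (measurableTypeR R)) g ->
  (forall t, 0 < t < 1 -> 0 <= g t) ->
  measurable E -> E `<=` `]0, 1[ ->
  Q.-integrable E (EFin \o h) ->
  (\int[Q]_(t in E) (h t)%:E = \int[mu]_(t in E) (h t * g t)%:E)%E.
Proof.
move=> Qg mg g0 mE E01 ih.
have Qmu : Q `<< mu.
  apply/null_content_dominatesP => A mA muA0; rewrite Qg//.
  apply: null_set_integral => //; first exact: measurableI.
    apply/measurable_EFinP; apply: measurable_funS mg => //.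
  by apply: subset_measure0 muA0 => //; exact: measurableI.
under [RHS]eq_integral do rewrite EFinM.
rewrite -(Radon_Nikodym_change_of_variables Qmu)//.
have mh := measurable_int _ ih.
apply: ae_eq_integral => //.
- apply: emeasurable_funM => //; apply: (measurable_int mu).
  apply: (integrableS _ _ (@subsetT _ _)) => //=.
  exact: Radon_Nikodym_integrable.
- apply: emeasurable_funM => //; apply/measurable_EFinP.
  exact: measurable_funS mg.
- apply: ae_eqe_mul2l => /=; rewrite Radon_NikodymE//=.
  case: cid => /= k [k1 k2 k3].
  apply: integral_ae_eq => //=.
  + exact: integrableS k2.
  + by apply/measurable_EFinP; exact: measurable_funS mg.
  + move=> A AE mA; rewrite -k3//= Qg// setIidl//.
    exact: subset_trans E01.
Qed.

Lemma has_density_01_mass (R : realType)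
    (mu : {measure set (measurableTypeR R) -> \bar R}) (g : R -> R)
    (Q : probability (measurableTypeR R) R) :
  has_density_01 mu g Q -> Q `]0%R, 1%R[%classic = 1%E.
Proof.
by move=> Qg; rewrite -(probability_setT Q) !Qg// setTI setIid.
Qed.

Section probability_on_01.
Context (R : realType) (Q : probability (measurableTypeR R) R).
Hypothesis Q01 : Q `]0%R, 1%R[%classic = 1%E.

Let mI : measurable (`]0%R, 1%R[%classic : set (measurableTypeR R)).
Proof. exact: measurable_itv. Qed.

Lemma integral_01 (h : R -> R) :
  measurable_fun (setT : set (measurableTypeR R)) h ->
  (\int[Q]_t (h t)%:E = \int[Q]_(t in `]0%R, 1%R[) (h t)%:E)%E.
Proof.
move=> mh; rewrite [RHS]integral_mkcond; apply: ae_eq_integral => //.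
- exact/measurable_EFinP.
- apply/(measurable_restrictT _ _).1 => //.
  by apply/measurable_EFinP; exact: measurable_funS mh.
- exists (~` `]0%R, 1%R[%classic); split; first exact: measurableC.
    by rewrite [LHS]probability_setC// [X in (_ - X)%E]Q01 subee.
  move=> t /= /not_implyP[_]; rewrite patchE.
  by case: ifPn => // /negP t01 _ ?; apply: t01; rewrite inE.
Qed.

Lemma integrable_01 (M : R) (h : R -> R) :
  measurable_fun (`]0, 1[ : set (measurableTypeR R)) h ->
  (forall t, 0 < t < 1 -> `|h t| <= M) -> Q.-integrable `]0, 1[ (EFin \o h).
Proof.
move=> mh hM; apply: (@integrable_bounded _ _ _ _ _ M) => //.
  by rewrite ltey_eq fin_num_measure.
Qed.

(** The variance is unchanged by centring at an arbitrary point [q] instead of the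
    mean; in the application [q] is the minimizer of the loss, around which the
    moments are accessible. *)
Lemma variance_01 (q : R) :
  'V_Q[idfun : measurableTypeR R -> R] =
  (\int[Q]_(t in `]0, 1[) (t - q) ^+ 2 -
   (\int[Q]_(t in `]0, 1[) (t - q)) ^+ 2)%:E.
Proof.
pose D := (`]0%R, 1%R[%classic : set (measurableTypeR R)).
have mid : measurable_fun (setT : set (measurableTypeR R)) (fun t : R => t).
  exact: measurable_id.
have mB c : measurable_fun (setT : set (measurableTypeR R)) (fun t : R => t - c).
  exact: measurable_funB.
have PDc (c : R) : \int[Q]_(_ in D) c = c.
  by rewrite Rintegral_cst// [X in fine X]Q01 mulr1.
have iB c : Q.-integrable D (EFin \o (fun t => t - c)).
  apply: (@integrable_01 (1 + `|c|)); first exact: measurable_funS (mB c).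
  move=> t /andP[t0 t1]; rewrite (le_trans (ler_normB _ _))// lerD2r.
  by rewrite gtr0_norm// ltW.
have iB2 c : Q.-integrable D (EFin \o (fun t => (t - c) ^+ 2)).
  apply: (@integrable_01 ((1 + `|c|) ^+ 2)).
    by apply: measurable_funX; exact: measurable_funS (mB c).
  move=> t /andP[t0 t1]; rewrite normrX lerXn2r ?nnegrE// ?addr_ge0//.
  by rewrite (le_trans (ler_normB _ _))// lerD2r gtr0_norm// ltW.
have iid : Q.-integrable D (EFin \o (fun t => t)).
  apply: (@integrable_01 1); first exact: measurable_funS mid.
  by move=> t /andP[t0 t1]; rewrite gtr0_norm// ltW.
have icst (c : R) : Q.-integrable D (EFin \o (fun=> c)).
  by apply: (@integrable_01 `|c|).
rewrite /variance unlock; set m := fine _.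
rewrite unlock.
have -> : (\int[Q]_t ((((idfun : measurableTypeR R -> R) \- cst m) *
    ((idfun : measurableTypeR R -> R) \- cst m))%R t)%:E)%E =
    (\int[Q]_(t in D) ((t - m) ^+ 2)%:E)%E.
  by rewrite -integral_01//; exact: measurable_funX.
have mE : m - q = \int[Q]_(t in D) (t - q).
  rewrite RintegralB//.
  by rewrite PDc /m unlock integral_01.
rewrite -[LHS]fineK; last by apply: (integrable_fin_num _ (iB2 m)).
congr EFin; rewrite -/(Rintegral Q D (fun t => (t - m) ^+ 2)).
rewrite -mE.
have sqE t : (t - m) ^+ 2 =
    (t - q) ^+ 2 - ((2 * (m - q)) * (t - q) - (m - q) ^+ 2) by ring.
under eq_Rintegral do rewrite sqE.
have iZ : Q.-integrable D (EFin \o (fun t => (2 * (m - q)) * (t - q))).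
  exact: (integrableZl mI (2 * (m - q)) (iB q)).
rewrite RintegralB//=; last exact: (integrableB mI iZ (icst ((m - q) ^+ 2))).
rewrite RintegralB// RintegralZl// PDc -mE; ring.
Qed.

End probability_on_01.

(** * Integrals over a segment and approximate identities *)

Section segment_integrals.
Context (R : realType) (a b : R).
Hypothesis ab : a < b.
Let mu := @lebesgue_measure R.
Implicit Types (f g h phi psi : R -> R).

Let mI : measurable (`[a, b]%classic : set (measurableTypeR R)).
Proof. exact: measurable_itv. Qed.

Lemma continuous_integrable_segment f : {in `[a, b], continuous f} ->
  mu.-integrable `[a, b] (EFin \o f).
Proof.
move=> cf; apply: continuous_compact_integrable; first exact: segment_compact.
by apply: continuous_in_subspaceT => x; rewrite inE; exact: cf.
Qed.

Lemma Rintegral_cst_segment (c : R) : \int[mu]_(_ in `[a, b]) c = c * (b - a).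
Proof.
by rewrite Rintegral_cst//= lebesgue_measure_itv/= lte_fin ab.
Qed.

Lemma Rintegral_derive_segment f g :
  (forall t, a <= t <= b -> is_derive t 1 f (g t)) ->
  {in `[a, b], continuous g} -> \int[mu]_(t in `[a, b]) g t = f b - f a.
Proof.
move=> fg cg; have cf t : a <= t <= b -> {for t, continuous f}.
  by move=> /fg ft; apply/differentiable_continuous/derivable1_diffP.
rewrite /Rintegral (@continuous_FTC2 _ _ f)//.
- by apply: continuous_in_subspaceT => x; rewrite inE; exact: cg.
- split.
  + move=> t; rewrite in_itv/= => /andP[ta tb].
    have ft : is_derive t 1 f (g t) by apply: fg; rewrite !ltW.
    exact: ex_derive.
  + by apply: cvg_at_right_filter; apply: cf; rewrite lexx ltW.
  + by apply: cvg_at_left_filter; apply: cf; rewrite lexx ltW.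
- move=> t; rewrite in_itv/= => /andP[ta tb].
  have ft : is_derive t 1 f (g t) by apply: fg; rewrite !ltW.
  by rewrite derive1E; exact: derive_val.
Qed.

(** The kernels [k n] may be signed: a uniform L1 bound replaces positivity, and
    their total masses may have any limit. *)
Section approximate_identity.
Context (x0 C : R) (k : nat -> R -> R).
Hypothesis x0ab : a <= x0 <= b.
Hypothesis ck : forall n, {in `[a, b], continuous (k n)}.
Hypothesis kC : \forall n \near \oo, \int[mu]_(t in `[a, b]) `|k n t| <= C.
Hypothesis k_off : forall delta eta : R, 0 < delta -> 0 < eta ->
  \forall n \near \oo, forall t, a <= t <= b -> delta <= `|t - x0| ->
  `|k n t| <= eta.

(* A test function vanishing at x0 is small near x0, where the L1 bound on the
   kernel suffices, and bounded elsewhere, where the kernel is small. *)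
Let approximate_identity0 psi : {in `[a, b], continuous psi} -> psi x0 = 0 ->
  \int[mu]_(t in `[a, b]) (psi t * k n t) @[n --> \oo] --> 0.
Proof.
move=> cpsi psi0.
have cnpsi : {in `[a, b], continuous (fun t => `|psi t|)}.
  by move=> t tab; apply: cvg_norm; exact: cpsi.
have [m mab psim] : exists2 m, m \in `[a, b] & forall t, t \in `[a, b] ->
    `|psi t| <= `|psi m|.
  apply: (@EVT_max _ (fun t => `|psi t|)); first exact: ltW.
  by apply: continuous_in_subspaceT => x; rewrite inE; exact: cnpsi.
set M := `|psi m| in psim.
have M0 : 0 <= M by rewrite normr_ge0.
apply/cvgr0Pnorm_le => e e0.
pose C' := `|C| + 1; pose eps := e / 2 / C'.
pose eta := e / 2 / ((M + 1) * (b - a + 1)).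
have C'0 : 0 < C' by rewrite ltr_wpDl.
have ba0 : 0 < b - a by rewrite subr_gt0.
have eps0 : 0 < eps by rewrite !divr_gt0.
have Mba0 : 0 < (M + 1) * (b - a + 1).
  by rewrite mulr_gt0// ?ltr_wpDl// ltW.
have eta0 : 0 < eta by rewrite divr_gt0// divr_gt0.
have [delta/= delta0 psid] : \forall t \near x0, `|psi t| <= eps.
  have : psi t @[t --> x0] --> 0 by rewrite -psi0; apply: cpsi; rewrite in_itv.
  by move=> /cvgr0Pnorm_le; apply.
near=> n.
have cpk : {in `[a, b], continuous (fun t => psi t * k n t)}.
  by move=> t tab; apply: cvgM; [exact: cpsi|exact: ck].
have cnk : {in `[a, b], continuous (fun t => `|k n t|)}.
  by move=> t tab; apply: cvg_norm; exact: ck.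
rewrite (le_trans (le_normr_Rintegral _ _))//.
  exact: continuous_integrable_segment.
apply: (@le_trans _ _ (\int[mu]_(t in `[a, b]) (eps * `|k n t| + M * eta))).
  apply: le_Rintegral => //.
  - apply: continuous_integrable_segment => t tab.
    by apply: cvg_norm; exact: cpk.
  - apply: continuous_integrable_segment => t tab.
    apply: cvgD; last exact: cvg_cst.
    by apply: cvgM; [exact: cvg_cst|exact: cnk].
  - move=> t tab; rewrite normrM; have [td|td] := ltP `|x0 - t| delta.
      rewrite (le_trans (ler_wpM2r _ (psid _ _)))//.
      by rewrite lerDl mulr_ge0// ltW.
    apply: ler_wpDl; first by rewrite mulr_ge0// ltW.
    apply: ler_pM => //; first exact: psim.
    have : delta <= `|t - x0| by rewrite distrC.
    by move: t tab {td}; near: n; exact: k_off.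
rewrite RintegralD//; last 2 first.
- apply: continuous_integrable_segment => t tab.
  by apply: cvgM; [exact: cvg_cst|exact: cnk].
- by apply: continuous_integrable_segment => t tab; exact: cvg_cst.
rewrite RintegralZl//; last exact: continuous_integrable_segment.
rewrite Rintegral_cst_segment (splitr e) lerD//.
  rewrite /eps mulrAC ler_pdivrMr// ler_pM2l ?divr_gt0//.
  rewrite (@le_trans _ _ C)//; first by near: n.
  by rewrite /C' (le_trans (ler_norm _))// lerDl.
rewrite (_ : M * eta * (b - a) =
    e / 2 * (M * (b - a) / ((M + 1) * (b - a + 1)))); last by rewrite /eta; ring.
rewrite -[leRHS]mulr1 ler_pM2l ?divr_gt0// ler_pdivrMr// mul1r.
by rewrite ler_pM ?lerDl// ltW.
Unshelve. all: by end_near. Qed.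

Lemma approximate_identity phi (c : R) : {in `[a, b], continuous phi} ->
  \int[mu]_(t in `[a, b]) k n t @[n --> \oo] --> c ->
  \int[mu]_(t in `[a, b]) (phi t * k n t) @[n --> \oo] --> phi x0 * c.
Proof.
move=> cphi kc; pose psi t := phi t - phi x0.
have cpsi : {in `[a, b], continuous psi}.
  by move=> t tab; apply: cvgB; [exact: cphi|exact: cvg_cst].
have E n : \int[mu]_(t in `[a, b]) (phi t * k n t) =
    \int[mu]_(t in `[a, b]) (psi t * k n t) +
    phi x0 * \int[mu]_(t in `[a, b]) k n t.
  have ik := continuous_integrable_segment (@ck n).
  rewrite -RintegralZl// -RintegralD//.
  - by apply: eq_Rintegral => t _; rewrite /psi; ring.
  - apply: continuous_integrable_segment => t tab.
    by apply: cvgM; [exact: cpsi|exact: ck].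
  - apply: continuous_integrable_segment => t tab.
    by apply: cvgM; [exact: cvg_cst|exact: ck].
under eq_cvg do rewrite E.
rewrite -[phi x0 * c]add0r; apply: cvgD.
  by apply: approximate_identity0 => //; rewrite /psi subrr.
by apply: cvgM => //; exact: cvg_cst.
Qed.

End approximate_identity.
End segment_integrals.

(** * Laplace asymptotics of the rescaled moments *)

(** The weight is normalized to have integral 1 over the segment.  Its phase enters
    only through the differential equation [kappa_ode], the source of all the
    exact formulas below. *)
Section laplace_moments.
Context (R : realType) (a b x0 : R) (g : R -> R) (q : nat -> R).
Context (kappa : nat -> R -> R).
Let mu := @lebesgue_measure R.
Hypothesis a_ge0 : 0 <= a.
Hypothesis b_le1 : b <= 1.
Hypothesis x0ab : a < x0 < b.
Hypothesis cg : {in `[a, b], continuous g}.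
Hypothesis g_gt0 : forall t, a <= t <= b -> 0 < g t.
Hypothesis q01 : forall n, 0 <= q n <= 1.
Hypothesis kappa_ge0 : forall n t, 0 <= kappa n t.
Hypothesis kappa_ode : forall n t, a <= t <= b ->
  is_derive t 1 (kappa n) (- n%:R * (t - q n) * g t * kappa n t).
Hypothesis kappa1 : forall n, \int[mu]_(t in `[a, b]) kappa n t = 1.
Hypothesis kappa_off : forall delta eta : R, 0 < delta -> 0 < eta ->
  \forall n \near \oo, forall t, a <= t <= b -> delta <= `|t - x0| ->
  n%:R * kappa n t <= eta.
Implicit Types phi : R -> R.

(** The deviation from [q n] measured in units of the expected width
    n^(-1/2) of the peak. *)
Definition rescaled (n : nat) (t : R) : R := Num.sqrt n%:R * (t - q n).

Let z := rescaled.

Let ab : a < b. Proof. by case/andP: x0ab => /lt_trans; exact. Qed.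

Let x0ab' : a <= x0 <= b. Proof. by case/andP: x0ab => ? ?; rewrite !ltW. Qed.

Let sqrtn2 n : Num.sqrt n%:R * Num.sqrt n%:R = n%:R :> R.
Proof. by rewrite -expr2 sqr_sqrtr. Qed.

Let ckappa n : {in `[a, b], continuous (kappa n)}.
Proof.
move=> t; rewrite in_itv => /(@kappa_ode n) dk.
exact/differentiable_continuous/derivable1_diffP.
Qed.

Let cz n t : {for t, continuous (z n)}.
Proof. by apply: cvgM; [exact: cvg_cst|apply: cvgB => //; exact: cvg_cst]. Qed.

Let czgk n : {in `[a, b], continuous (fun t => z n t * (g t * kappa n t))}.
Proof.
move=> t tab; apply: cvgM; first exact: cz.
by apply: cvgM; [exact: cg|exact: ckappa].
Qed.

Let czzgk n :
  {in `[a, b], continuous (fun t => z n t ^+ 2 * (g t * kappa n t))}.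
Proof.
move=> t tab; rewrite (_ : (fun _ => _) =
    (fun t => z n t * (z n t * (g t * kappa n t)))).
  by apply: cvgM; [exact: cz|exact: czgk].
by apply/funext => u; ring.
Qed.

Let tq1 n t : a <= t <= b -> `|t - q n| <= 1.
Proof.
move=> /andP[ta tb]; case/andP: (q01 n) => q0 q1.
by rewrite ler_norml; have := a_ge0; have := b_le1; lra.
Qed.

Let sqrt_le n : (0 < n)%N -> Num.sqrt n%:R <= n%:R :> R.
Proof.
move=> n0; have n1 : (1 : R) <= n%:R by rewrite ler1n.
by rewrite -[leRHS]sqrtn2 ler_peMl ?sqrtr_ge0// -[leLHS]sqrtr1 ler_wsqrtr.
Qed.

Let boundary_cvg0 : (kappa n a + kappa n b) @[n --> \oo] --> 0.
Proof.
case/andP: x0ab => ax xb; apply/cvgr0Pnorm_le => e e0.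
have d0 : 0 < Num.min (x0 - a) (b - x0) by rewrite lt_min !subr_gt0 ax.
have e2 : 0 < e / 2 by rewrite divr_gt0.
near=> n.
have n0 : (0 < n)%N by near: n; exact: nbhs_infty_gt.
have ke t : a <= t <= b -> Num.min (x0 - a) (b - x0) <= `|t - x0| ->
    kappa n t <= e / 2.
  move=> tab td; apply: (@le_trans _ _ (n%:R * kappa n t)).
    by rewrite ler_peMl// ler1n.
  by move: t tab td; near: n; exact: kappa_off.
rewrite ger0_norm ?addr_ge0// (splitr e) lerD// ke ?lexx ?(ltW ab)//=.
  by rewrite ltr0_norm ?subr_lt0// opprB ge_min lexx.
by rewrite gtr0_norm ?subr_gt0// ge_min lexx orbT.
Unshelve. all: by end_near. Qed.

Let off_of_bound (k : nat -> R -> R) :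
  (forall n t, (0 < n)%N -> a <= t <= b ->
    `|k n t| <= n%:R * (g t * kappa n t)) ->
  forall delta eta : R, 0 < delta -> 0 < eta ->
  \forall n \near \oo, forall t, a <= t <= b -> delta <= `|t - x0| ->
  `|k n t| <= eta.
Proof.
move=> kle delta eta delta0 eta0.
have [m mab gm] : exists2 m, m \in `[a, b] & forall t, t \in `[a, b] ->
    g t <= g m.
  apply: (@EVT_max _ g); first exact: ltW.
  by apply: continuous_in_subspaceT => x; rewrite inE; exact: cg.
have gm0 : 0 < g m by apply: g_gt0; rewrite in_itv in mab.
near=> n => t tab td.
have n0 : (0 < n)%N by near: n; exact: nbhs_infty_gt.
rewrite (le_trans (kle n t n0 tab))//.
apply: (@le_trans _ _ (g m * (n%:R * kappa n t))).
  rewrite mulrCA ler_wpM2r ?mulr_ge0//.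
  by apply: gm; rewrite in_itv.
rewrite mulrC -ler_pdivlMr//.
by move: t tab td; near: n; apply: kappa_off => //; rewrite divr_gt0.
Unshelve. all: by end_near. Qed.

Lemma laplace_moment0 phi : {in `[a, b], continuous phi} ->
  \int[mu]_(t in `[a, b]) (phi t * kappa n t) @[n --> \oo] --> phi x0.
Proof.
move=> cphi; rewrite -[phi x0]mulr1.
apply: (@approximate_identity _ _ _ ab _ 1) => //.
- apply: nearW => n; under eq_Rintegral do rewrite ger0_norm//.
  by rewrite kappa1.
- move=> delta eta d0 e0; near=> n => t tab td.
  have n0 : (0 < n)%N by near: n; exact: nbhs_infty_gt.
  rewrite ger0_norm//; apply: (@le_trans _ _ (n%:R * kappa n t)).
    by rewrite ler_peMl// ler1n.
  by move: t tab td; near: n; exact: kappa_off.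
- by under eq_cvg do rewrite kappa1; exact: cvg_cst.
Unshelve. all: by end_near. Qed.

(* The integrand is the derivative of - kappa, up to a factor sqrt n. *)
Let Rintegral_zgk n : Num.sqrt n%:R *
  \int[mu]_(t in `[a, b]) (z n t * (g t * kappa n t)) = kappa n a - kappa n b.
Proof.
rewrite -RintegralZl//; last exact: continuous_integrable_segment.
pose k' t := - (Num.sqrt n%:R * (z n t * (g t * kappa n t))).
have ck' : {in `[a, b], continuous k'}.
  move=> t tab; apply: cvgN.
  by apply: cvgM; [exact: cvg_cst|exact: czgk].
have dk t : a <= t <= b -> is_derive t 1 (kappa n) (k' t).
  move=> tab; have := kappa_ode n tab; congr is_derive.
  rewrite /k' /z /rescaled; set s := Num.sqrt _.
  by rewrite -(sqrtn2 n) -/s; ring.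
rewrite -[RHS]opprB -(Rintegral_derive_segment ab dk ck').
rewrite -mulN1r -RintegralZl//; last exact: continuous_integrable_segment.
by apply: eq_Rintegral => t _; rewrite /k'; ring.
Qed.

(* The derivative of (t - q) kappa is kappa - z^2 g kappa: this is where the
   variance 1 / (n g) of the peak comes from. *)
Let Rintegral_zzgk n :
  \int[mu]_(t in `[a, b]) (z n t ^+ 2 * (g t * kappa n t)) =
  1 - ((b - q n) * kappa n b - (a - q n) * kappa n a).
Proof.
pose h' t := kappa n t - z n t ^+ 2 * (g t * kappa n t).
have ch' : {in `[a, b], continuous h'}.
  by move=> t tab; apply: cvgB; [exact: ckappa|exact: czzgk].
have dh t : a <= t <= b ->
    is_derive t 1 (fun t => (t - q n) * kappa n t) (h' t).
  move=> tab; have dk := kappa_ode n tab.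
  have dt : is_derive t 1 (fun t => t - q n) 1.
    by apply: is_derive_eq; rewrite subr0.
  apply: is_derive_eq; rewrite /GRing.scale/= /h' /z /rescaled.
  by rewrite exprMn sqr_sqrtr//; ring.
rewrite -(Rintegral_derive_segment ab dh ch').
rewrite RintegralB//; try exact: continuous_integrable_segment.
by rewrite kappa1; ring.
Qed.

Let k2_cvg1 :
  \int[mu]_(t in `[a, b]) (z n t ^+ 2 * (g t * kappa n t)) @[n --> \oo] --> (1 : R).
Proof.
rewrite -[X in _ --> X]subr0; under eq_cvg do rewrite Rintegral_zzgk.
apply: cvgB; first exact: cvg_cst.
apply: norm_cvg0; apply: squeeze_cvgr (cvg_cst 0) boundary_cvg0.
apply: nearW => n; rewrite normr_ge0/= (le_trans (ler_normB _ _))// addrC !normrM.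
rewrite !(ger0_norm (kappa_ge0 _ _)) lerD// ler_piMl// tq1 ?lexx ?ltW//.
Qed.

(** The kernel with a known limit mass is z^2 g kappa, so phi is written as
    (phi / g) g. *)
Lemma laplace_moment2 phi : {in `[a, b], continuous phi} ->
  \int[mu]_(t in `[a, b]) (phi t * (rescaled n t ^+ 2 * kappa n t)) @[n --> \oo]
    --> phi x0 / g x0.
Proof.
move=> cphi; rewrite -[_ / _]mulr1.
have cphig : {in `[a, b], continuous (fun t => phi t / g t)}.
  move=> t tab; apply: cvgM; first exact: cphi.
  apply: cvgV; last exact: cg.
  by rewrite gt_eqF// g_gt0//; rewrite in_itv in tab.
have E n : \int[mu]_(t in `[a, b]) (phi t * (z n t ^+ 2 * kappa n t)) =
    \int[mu]_(t in `[a, b]) (phi t / g t * (z n t ^+ 2 * (g t * kappa n t))).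
  apply: eq_Rintegral => t; rewrite inE/= in_itv/= => /g_gt0 gt0.
  by field; rewrite gt_eqF.
under eq_cvg do rewrite E.
apply: (@approximate_identity _ _ _ ab x0 2
  (fun n t => z n t ^+ 2 * (g t * kappa n t)) _ _ _ _
  (fun t => phi t / g t)) => //.
- near=> n; rewrite (_ : Rintegral _ _ _ =
      \int[mu]_(t in `[a, b]) (z n t ^+ 2 * (g t * kappa n t))); last first.
    apply: eq_Rintegral => t; rewrite inE/= in_itv/= => /g_gt0/ltW gt0.
    by rewrite ger0_norm// mulr_ge0 ?sqr_ge0// mulr_ge0.
  near: n; apply: (cvgr_le 1 k2_cvg1); lra.
- apply: off_of_bound => n t n0 tab.
  have gk0 : 0 <= g t * kappa n t by rewrite mulr_ge0// ltW// g_gt0.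
  rewrite normrM (ger0_norm gk0) ler_wpM2r//.
  rewrite /z /rescaled exprMn sqr_sqrtr// normrM ger0_norm// ler_piMr//.
  by rewrite normrX exprn_ile1// tq1.
Unshelve. all: by end_near. Qed.

(** The kernel z g kappa is signed, with mass (kappa a - kappa b) / sqrt n tending
    to 0.  Its L1 norm is bounded since |z| <= 1 + z^2 reduces it to the two
    kernels already controlled. *)
Lemma laplace_moment1 phi : {in `[a, b], continuous phi} ->
  \int[mu]_(t in `[a, b]) (phi t * (rescaled n t * kappa n t)) @[n --> \oo] --> 0.
Proof.
move=> cphi; rewrite -(mulr0 (phi x0 / g x0)).
have cphig : {in `[a, b], continuous (fun t => phi t / g t)}.
  move=> t tab; apply: cvgM; first exact: cphi.
  apply: cvgV; last exact: cg.
  by rewrite gt_eqF// g_gt0//; rewrite in_itv in tab.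
have E n : \int[mu]_(t in `[a, b]) (phi t * (z n t * kappa n t)) =
    \int[mu]_(t in `[a, b]) (phi t / g t * (z n t * (g t * kappa n t))).
  apply: eq_Rintegral => t; rewrite inE/= in_itv/= => /g_gt0 gt0.
  by field; rewrite gt_eqF.
under eq_cvg do rewrite E.
have gk0 n t : a <= t <= b -> 0 <= g t * kappa n t.
  by move=> tab; rewrite mulr_ge0// ltW// g_gt0.
have cgk n : {in `[a, b], continuous (fun t => g t * kappa n t)}.
  by move=> t tab; apply: cvgM; [exact: cg|exact: ckappa].
apply: (@approximate_identity _ _ _ ab x0 (g x0 + 1 + 2)
  (fun n t => z n t * (g t * kappa n t)) _ _ _ _
  (fun t => phi t / g t)) => //.
- near=> n; apply: (@le_trans _ _ (\int[mu]_(t in `[a, b])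
      (g t * kappa n t + z n t ^+ 2 * (g t * kappa n t)))).
    apply: le_Rintegral => //.
    + apply: continuous_integrable_segment => t tab.
      by apply: cvg_norm; exact: czgk.
    + apply: continuous_integrable_segment => t tab.
      by apply: cvgD; [exact: cgk|exact: czzgk].
    + move=> t; rewrite /= in_itv/= => tab.
      rewrite normrM (ger0_norm (gk0 _ _ tab)) -[X in X + _]mul1r -mulrDl.
      rewrite ler_wpM2r ?gk0// -[z n t ^+ 2]real_normK ?num_real//.
      by have := sqr_ge0 (`|z n t| - 1); nra.
  rewrite RintegralD//; try exact: continuous_integrable_segment.
  rewrite lerD//.
    by near: n; apply: (cvgr_le (g x0) (laplace_moment0 cg)); rewrite ltrDl.
  by near: n; apply: (cvgr_le 1 k2_cvg1); lra.
- apply: off_of_bound => n t n0 tab.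
  rewrite normrM (ger0_norm (gk0 _ _ tab)) ler_wpM2r ?gk0//.
  rewrite /z /rescaled normrM (ger0_norm (sqrtr_ge0 _)).
  by rewrite -[leRHS]mulr1 ler_pM// ?sqrtr_ge0// ?sqrt_le// tq1.
- apply: norm_cvg0; apply: squeeze_cvgr (cvg_cst 0) boundary_cvg0.
  near=> n; rewrite normr_ge0/=.
  have n0 : (0 < n)%N by near: n; exact: nbhs_infty_gt.
  apply: (@le_trans _ _ `|kappa n a - kappa n b|); last first.
    by rewrite (le_trans (ler_normB _ _))// !ger0_norm.
  rewrite -Rintegral_zgk normrM ler_peMl// ger0_norm ?sqrtr_ge0//.
  by rewrite -[leLHS]sqrtr1 ler_wsqrtr// ler1n.
Unshelve. all: by end_near. Qed.

End laplace_moments.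

(** * Concentration of the Gibbs weight at the true parameter *)

Section gibbs_concentration.
Context (R : realType) (f : R -> R).
Let mu := @lebesgue_measure R.
Hypothesis f_C1 : C1_01 f.
Hypothesis f_sym : forall x : R, 0 < x < 1 ->
  x * f^`()%classic x = (1 - x) * f^`()%classic (1 - x).
Hypothesis f'_lt0 : forall x : R, 0 < x < 1 -> f^`()%classic x < 0.

Definition empirical_loss (q t : R) : R := q * f t + (1 - q) * f (1 - t).

(** The second derivative in t of the loss at its minimizer t = q is
    [curvature q]. *)
Definition curvature (t : R) : R := - f^`()%classic t / (1 - t).

Let loss := empirical_loss.
Let g := curvature.

Lemma curvature_gt0 (t : R) : 0 < t < 1 -> 0 < curvature t.
Proof.
move=> /andP[t0 t1]; rewrite divr_gt0 ?subr_gt0// oppr_gt0.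
by apply: f'_lt0; rewrite t0.
Qed.

Lemma curvature_continuous (t : R) : 0 < t < 1 -> {for t, continuous curvature}.
Proof.
move=> t01; have [_ cf] := f_C1 t01.
apply: cvgM; first exact: cvgN.
apply: cvgV; first by rewrite gt_eqF// subr_gt0; case/andP: t01.
by apply: cvgB => //; exact: cvg_cst.
Qed.

(** By symmetry f'(1 - t) = t f'(t) / (1 - t), so the derivative
    q f'(t) - (1 - q) f'(1 - t) factors through t - q. *)
Lemma is_derive_empirical_loss (q t : R) : 0 < t < 1 ->
  is_derive t 1 (empirical_loss q) (curvature t * (t - q)).
Proof.
move=> t01; have t01' : 0 < 1 - t < 1.
  by case/andP: t01 => t0 t1; rewrite subr_gt0 t1 ltrBlDr ltrDl.
have [df _] := f_C1 t01; have [df' _] := f_C1 t01'.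
have Df : is_derive t 1 f (f^`()%classic t).
  by rewrite derive1E; exact: derivableP.
have Df' : is_derive (1 - t) 1 f (f^`()%classic (1 - t)).
  by rewrite derive1E; exact: derivableP.
have D1 : is_derive t 1 (fun t : R => 1 - t) (-1).
  by apply: is_derive_eq; rewrite add0r mul1r.
have Dc : is_derive t 1 (fun t : R => f (1 - t)) (- f^`()%classic (1 - t)).
  have := @is_derive1_comp _ f (fun t => 1 - t) t _ _ Df' D1.
  by rewrite mulrN1.
apply: is_derive_eq; rewrite /GRing.scale/= /curvature.
have t1 : 1 - t != 0 by rewrite gt_eqF//; case/andP: t01'.
have -> : f^`()%classic (1 - t) = t * f^`()%classic t / (1 - t).
  by rewrite (f_sym t01) mulrC mulKf.
by field.
Qed.

Let closs (q t : R) : 0 < t < 1 -> {for t, continuous (loss q)}.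
Proof.
move=> t01; have dl := is_derive_empirical_loss q t01.
exact/differentiable_continuous/derivable1_diffP.
Qed.

Let loss_MVT (q s t : R) : 0 < s -> s < t -> t < 1 ->
  exists2 c, s < c < t & loss q t - loss q s = g c * (c - q) * (t - s).
Proof.
move=> s0 st t1.
have [||c] := @MVT _ (loss q) (fun t => g t * (t - q)) s t st.
- move=> x; rewrite in_itv/= => /andP[sx xt].
  by apply: is_derive_empirical_loss; rewrite (lt_trans s0)//= (lt_trans xt).
- apply: continuous_in_subspaceT => x; rewrite inE/= in_itv/= => /andP[sx xt].
  by apply: closs; rewrite (lt_le_trans s0)//= (le_lt_trans xt).
by rewrite in_itv/= => cst E; exists c.
Qed.

Lemma empirical_loss_lt_right (q s t : R) : 0 < s -> q <= s -> s < t -> t < 1 ->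
  empirical_loss q s < empirical_loss q t.
Proof.
move=> s0 qs st t1; have [c /andP[sc ct] E] := loss_MVT q s0 st t1.
have gc : 0 < g c.
  by apply: curvature_gt0; rewrite (lt_trans s0)//= (lt_trans ct).
have qc : q < c by exact: le_lt_trans sc.
rewrite -subr_gt0 [X in _ < X]E pmulr_lgt0 ?subr_gt0//.
by rewrite (pmulr_rgt0 _ gc) subr_gt0.
Qed.

Lemma empirical_loss_lt_left (q s t : R) : 0 < t -> t < s -> s <= q -> s < 1 ->
  empirical_loss q s < empirical_loss q t.
Proof.
move=> t0 ts sq s1; have [c /andP[tc cs] E] := loss_MVT q t0 ts s1.
have gc : 0 < g c.
  by apply: curvature_gt0; rewrite (lt_trans t0)//= (lt_trans cs).
have cq : c < q by exact: lt_le_trans sq.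
rewrite -subr_lt0 [X in X < _]E pmulr_llt0 ?subr_gt0//.
by rewrite (pmulr_rlt0 _ gc) subr_lt0.
Qed.

Lemma is_derive_gibbs_weight n (q t : R) : 0 < t < 1 ->
  is_derive t 1 (gibbs_weight f n q)
    (- n%:R * (t - q) * curvature t * gibbs_weight f n q t).
Proof.
move=> t01; have dl := is_derive_empirical_loss q t01.
have -> : gibbs_weight f n q = (fun t => expR (- n%:R * loss q t)) by [].
apply: is_derive_eq; rewrite /GRing.scale/=; ring.
Qed.

Lemma gibbs_weight_continuous n (q t : R) : 0 < t < 1 ->
  {for t, continuous (gibbs_weight f n q)}.
Proof.
move=> t01; have dl := is_derive_gibbs_weight n q t01.
exact/differentiable_continuous/derivable1_diffP.
Qed.

Section concentration.
Context (a b x0 : R) (q : nat -> R).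
Hypothesis a_gt0 : 0 < a.
Hypothesis b_lt1 : b < 1.
Hypothesis x0ab : a < x0 < b.
Hypothesis q01 : forall n, 0 <= q n <= 1.
Hypothesis q_cvg : q n @[n --> \oo] --> x0.

Definition segment_mass (n : nat) : R :=
  \int[mu]_(t in `[a, b]) gibbs_weight f n (q n) t.

Let ab : a < b. Proof. by case/andP: x0ab => /lt_trans; exact. Qed.

Let sub01 (t : R) : a <= t <= b -> 0 < t < 1.
Proof.
by move=> /andP[ta tb]; rewrite (lt_le_trans a_gt0)//= (le_lt_trans tb).
Qed.

Let x0_01 : 0 < x0 < 1.
Proof. by apply: sub01; case/andP: x0ab => ? ?; rewrite !ltW. Qed.

Let cw n : {in `[a, b], continuous (gibbs_weight f n (q n))}.
Proof.
by move=> t; rewrite in_itv/= => /sub01; exact: gibbs_weight_continuous.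
Qed.

(* It is enough to integrate the weight over a subsegment on which the loss is
   at most c. *)
Let segment_mass_ge n (c u v : R) : a <= u -> u < v -> v <= b ->
  (forall t, u <= t <= v -> loss (q n) t <= c) ->
  expR (- n%:R * c) * (v - u) <= segment_mass n.
Proof.
move=> au uv vb lossc.
have sub : `[u, v] `<=` `[a, b].
  move=> t /=; rewrite !in_itv/= => /andP[ut tv].
  by rewrite (le_trans au)//= (le_trans tv).
have iw : mu.-integrable `[a, b] (EFin \o gibbs_weight f n (q n)).
  exact: continuous_integrable_segment.
have iw' : mu.-integrable `[u, v] (EFin \o gibbs_weight f n (q n)).
  exact: (@integrableS _ _ R mu `[a, b]%classic `[u, v]%classic).
rewrite -(Rintegral_cst_segment uv).
apply: (@le_trans _ _ (\int[mu]_(t in `[u, v]) gibbs_weight f n (q n) t)).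
  apply: le_Rintegral => //.
  - by apply: continuous_integrable_segment => t _; exact: cvg_cst.
  - move=> t; rewrite /= in_itv/= => tuv; rewrite ler_expR !mulNr lerN2 ler_wpM2l//.
    exact: lossc.
rewrite /segment_mass /Rintegral fine_le//.
- exact: integrable_fin_num.
- exact: integrable_fin_num.
- apply: ge0_subset_integral => //.
    exact: measurable_int iw.
  by move=> t _; rewrite lee_fin expR_ge0.
Qed.

Lemma segment_mass_gt0 n : 0 < segment_mass n.
Proof.
have [m mab mP] : exists2 m, m \in `[a, b] & forall t, t \in `[a, b] ->
    loss (q n) t <= loss (q n) m.
  apply: EVT_max; first exact: ltW.
  apply: continuous_in_subspaceT => t; rewrite inE/= in_itv/= => /sub01.
  exact: closs.
apply: lt_le_trans (segment_mass_ge (c := loss (q n) m) _ ab _ _) => //.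
by rewrite mulr_gt0 ?expR_gt0 ?subr_gt0.
Qed.

Let loss_cvg t : loss (q n) t @[n --> \oo] --> loss x0 t.
Proof.
apply: cvgD; apply: cvgM => //; try exact: cvg_cst.
by apply: cvgB => //; exact: cvg_cst.
Qed.

(* The bound is uniform in t near x0 and in n large, since the loss is a convex
   combination of f t and f (1 - t) with weights converging to x0 and 1 - x0. *)
Let loss_near_x0 (c : R) : loss x0 x0 < c -> exists2 rho : R, 0 < rho &
  \forall n \near \oo, forall t, `|t - x0| <= rho -> loss (q n) t <= c.
Proof.
move=> xc; pose e := (c - loss x0 x0) / 2.
have e0 : 0 < e by rewrite divr_gt0 ?subr_gt0.
have cf x : 0 < x < 1 -> {for x, continuous f}.
  by move=> /f_C1[df _]; exact/differentiable_continuous/derivable1_diffP.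
have x01' : 0 < 1 - x0 < 1.
  by case/andP: x0_01 => x00 x01; rewrite subr_gt0 x01 ltrBlDr ltrDl.
have [r1/= r10 fr1] : \forall t \near x0, `|f x0 - f t| < e.
  by have /cvgrPdist_lt/(_ _ e0) := cf _ x0_01.
have [r2/= r20 fr2] : \forall t \near 1 - x0, `|f (1 - x0) - f t| < e.
  by have /cvgrPdist_lt/(_ _ e0) := cf _ x01'.
exists (Num.min r1 r2 / 2); first by rewrite divr_gt0// lt_min r10.
near=> n => t tr.
have trlt : `|t - x0| < Num.min r1 r2.
  have r0 : 0 < Num.min r1 r2 by rewrite lt_min r10.
  by rewrite (le_lt_trans tr)// ltr_pdivrMr// ltr_pMr// ltr1n.
have : `|f x0 - f t| < e.
  by apply: fr1; rewrite /= distrC (lt_le_trans trlt)// ge_min lexx.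
have : `|f (1 - x0) - f (1 - t)| < e.
  apply: fr2; rewrite /= (_ : 1 - x0 - (1 - t) = t - x0); last by ring.
  by rewrite (lt_le_trans trlt)// ge_min lexx orbT.
rewrite !ltr_distl => /andP[f2 f2'] /andP[f1 f1'].
have lossx : loss (q n) x0 <= loss x0 x0 + e.
  by near: n; apply: (cvgr_le _ (@loss_cvg x0)); rewrite ltrDl.
have cE : c = loss x0 x0 + e + e by rewrite /e; field.
rewrite cE (le_trans _ (lerD lossx (lexx e)))// /loss /empirical_loss.
case/andP: (q01 n) => q0 q1.
nra.
Unshelve. all: by end_near. Qed.

(* From exp x >= 1 + x^2 / 2. *)
Let exp_beats_linear (c r : R) : 0 < c -> 0 < r ->
  \forall n \near \oo, n%:R <= r * expR (n%:R * c).
Proof.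
move=> c0 r0; near=> n.
have n0 : (0 : R) < n%:R.
  by rewrite ltr0n; near: n; exact: nbhs_infty_gt.
have := @expR_ge1Dxn R (n%:R * c) 1%N (mulr_ge0 (ltW n0) (ltW c0)).
rewrite -(ler_pM2l r0) => /(le_trans _); apply.
rewrite mulrDr mulr1 ler_wpDl ?(ltW r0)//.
have -> : r * ((n%:R * c) ^+ 2 / 2`!%:R) = n%:R * (n%:R * (r * c ^+ 2 / 2)).
  by rewrite (_ : 2`! = 2)%N//; field.
rewrite ler_peMr ?(ltW n0)//.
have k0 : 0 < r * c ^+ 2 / 2 by rewrite divr_gt0// mulr_gt0// exprn_gt0.
rewrite -ler_pdivrMr//; near: n; exact: nbhs_infty_ger.
Unshelve. all: by end_near. Qed.

(** The limit loss at x0 -+ d exceeds its minimum by some gap > 0.  For n large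
    and by monotonicity of the loss, the loss is at least B = min + 2 gap / 3
    outside ]x0 - d, x0 + d[, while it is at most A = min + gap / 3 on a small
    segment around x0.  So the weight over the mass is exponentially small, of
    order exp (- n gap / 3). *)
Lemma gibbs_weight_off (delta eta : R) : 0 < delta -> 0 < eta ->
  \forall n \near \oo, forall t, 0 < t < 1 -> delta <= `|t - x0| ->
  n%:R * gibbs_weight f n (q n) t <= eta * segment_mass n.
Proof.
move=> delta0 eta0; case/andP: x0ab => ax xb.
pose d := Num.min delta (Num.min (x0 - a) (b - x0)).
have d0 : 0 < d by rewrite !lt_min delta0 !subr_gt0 ax.
have ddelta : d <= delta by rewrite ge_min lexx.
have da : d <= x0 - a by rewrite !ge_min lexx !orbT.
have db : d <= b - x0 by rewrite !ge_min lexx !orbT.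
pose u := x0 - d; pose v := x0 + d.
have au : a <= u by rewrite /u; lra.
have vb : v <= b by rewrite /v; lra.
have ux : u < x0 by rewrite ltrBlDr ltrDl.
have xv : x0 < v by rewrite ltrDl.
have u0 : 0 < u by exact: lt_le_trans au.
have v1 : v < 1 by exact: le_lt_trans b_lt1.
case/andP: x0_01 => x00 x01.
have gapu : loss x0 x0 < loss x0 u by exact: empirical_loss_lt_left.
have gapv : loss x0 x0 < loss x0 v by exact: empirical_loss_lt_right.
pose gap := Num.min (loss x0 u) (loss x0 v) - loss x0 x0.
have gap0 : 0 < gap by rewrite subr_gt0 lt_min gapu.
pose A := loss x0 x0 + gap / 3; pose B := loss x0 x0 + 2 * gap / 3.
have [rho rho0 lossA] : exists2 rho : R, 0 < rho &
    \forall n \near \oo, forall t, `|t - x0| <= rho -> loss (q n) t <= A.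
  by apply: loss_near_x0; rewrite ltrDl divr_gt0.
pose rho' := Num.min rho d.
have rho'0 : 0 < rho' by rewrite lt_min rho0.
near=> n => t /andP[t0 t1] td.
have qu : u <= q n by near: n; exact: (cvgr_ge _ q_cvg).
have qv : q n <= v by near: n; exact: (cvgr_le _ q_cvg).
have Bu : B <= loss (q n) u.
  near: n; apply: (cvgr_ge _ (@loss_cvg u)).
  have : gap <= loss x0 u - loss x0 x0 by rewrite lerD2r ge_min lexx.
  by rewrite /B; lra.
have Bv : B <= loss (q n) v.
  near: n; apply: (cvgr_ge _ (@loss_cvg v)).
  have : gap <= loss x0 v - loss x0 x0 by rewrite lerD2r ge_min lexx orbT.
  by rewrite /B; lra.
have Bt : B <= loss (q n) t.
  have [tx|xt] := leP t x0.
    have tu : t <= u.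
      move: td; rewrite ler0_norm ?subr_le0// opprB => td.
      by rewrite lerBrDl -lerBrDr (le_trans ddelta).
    move: tu; rewrite le_eqVlt => /predU1P[->//|tu].
    by rewrite (le_trans Bu)// ltW// empirical_loss_lt_left// (lt_trans ux).
  have vt : v <= t.
    move: td; rewrite gtr0_norm ?subr_gt0// => td.
    by rewrite -lerBrDl (le_trans ddelta).
  move: vt; rewrite le_eqVlt => /predU1P[<-//|vt].
  by rewrite (le_trans Bv)// ltW// empirical_loss_lt_right// (lt_trans x00).
have massA : expR (- n%:R * A) * (2 * rho') <= segment_mass n.
  have -> : 2 * rho' = x0 + rho' - (x0 - rho') by ring.
  have r1 : rho' <= rho by rewrite ge_min lexx.
  have r2 : rho' <= d by rewrite ge_min lexx orbT.
  apply: segment_mass_ge.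
  - by rewrite (le_trans au)// lerD2l lerN2.
  - by rewrite ltrD2l -subr_gt0 opprK addr_gt0.
  - by rewrite (le_trans _ vb)// lerD2l.
  move=> s /andP[s1 s2].
  have : `|s - x0| <= rho.
    rewrite ler_distl (le_trans _ s1) ?lerD2l ?lerN2//=.
    by rewrite (le_trans s2)// lerD2l.
  by move: s {s1 s2}; near: n.
have weightB : gibbs_weight f n (q n) t <= expR (- n%:R * B).
  by rewrite ler_expR !mulNr lerN2 ler_wpM2l.
apply: (@le_trans _ _ (n%:R * expR (- n%:R * B))); first by rewrite ler_wpM2l.
apply: le_trans (ler_wpM2l (ltW eta0) massA).
have -> : expR (- n%:R * A) = expR (n%:R * (gap / 3)) * expR (- n%:R * B).
  by rewrite -expRD; congr expR; rewrite /A /B; field.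
rewrite (_ : eta * _ = eta * (2 * rho') * expR (n%:R * (gap / 3)) *
  expR (- n%:R * B)); last by ring.
rewrite ler_wpM2r ?expR_ge0//.
near: n; apply: exp_beats_linear; first by rewrite divr_gt0.
by rewrite !mulr_gt0.
Unshelve. all: by end_near. Qed.

End concentration.
End gibbs_concentration.

(** * Moments and variance of the Gibbs posterior *)

Section posterior_moments.
Context (R : realType) (x0 : R) (f : R -> R).
Context (nu : probability (measurableTypeR R) R) (p : R -> R) (q : nat -> R).
Let mu := @lebesgue_measure R.
Hypothesis x0_01 : 0 < x0 < 1.
Hypothesis f_ge0 : forall x : R, 0 < x < 1 -> 0 <= f x.
Hypothesis f_C1 : C1_01 f.
Hypothesis f_sym : forall x : R, 0 < x < 1 ->
  x * f^`()%classic x = (1 - x) * f^`()%classic (1 - x).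
Hypothesis f'_lt0 : forall x : R, 0 < x < 1 -> f^`()%classic x < 0.
Hypothesis nu_prior : is_prior nu p.
Hypothesis q01 : forall n, 0 <= q n <= 1.
Hypothesis q_cvg : q n @[n --> \oo] --> x0.

(* A compact segment of ]0, 1[ around x0, away from the end points where f' and p
   may be unbounded. *)
Let a := x0 / 2.
Let b := (x0 + 1) / 2.

Let a0 : 0 < a. Proof. by case/andP: x0_01 => x00 _; rewrite divr_gt0. Qed.

Let b1 : b < 1.
Proof. by case/andP: x0_01 => _ x01; rewrite ltr_pdivrMr//; lra. Qed.

Let x0ab : a < x0 < b.
Proof. by case/andP: x0_01 => x00 x01; rewrite /a /b; lra. Qed.

Let ab : a < b. Proof. by case/andP: x0ab => /lt_trans; exact. Qed.

Let sub01 (t : R) : a <= t <= b -> 0 < t < 1.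
Proof. by move=> /andP[ta tb]; rewrite (lt_le_trans a0)//= (le_lt_trans tb). Qed.

Let S := segment_mass f a b q.

Let S0 n : 0 < S n.
Proof. exact: (segment_mass_gt0 f_C1 f_sym q a0 b1 x0ab). Qed.

Let kappa n t := gibbs_weight f n (q n) t / S n.

Let kappa_ge0 n t : 0 <= kappa n t.
Proof. by rewrite divr_ge0 ?expR_ge0// ltW. Qed.

Let ckappa n (t : R) : 0 < t < 1 -> {for t, continuous (kappa n)}.
Proof.
move=> t01; apply: cvgM; last exact: cvg_cst.
exact: gibbs_weight_continuous.
Qed.

Let kappa_ode n t : a <= t <= b -> is_derive t 1 (kappa n)
  (- n%:R * (t - q n) * curvature f t * kappa n t).
Proof.
move=> /sub01 t01; have dw := is_derive_gibbs_weight f_C1 f_sym n (q n) t01.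
apply: is_derive_eq; rewrite /GRing.scale/= /kappa; ring.
Qed.

Let kappa1 n : \int[mu]_(t in `[a, b]) kappa n t = 1.
Proof.
rewrite /kappa RintegralZr//; first exact: divff (lt0r_neq0 (S0 n)).
apply: continuous_integrable_segment => t; rewrite in_itv/= => /sub01.
exact: gibbs_weight_continuous.
Qed.

Let kappa_off (delta eta : R) : 0 < delta -> 0 < eta ->
  \forall n \near \oo, forall t, 0 < t < 1 -> delta <= `|t - x0| ->
  n%:R * kappa n t <= eta.
Proof.
move=> d0 e0.
have := gibbs_weight_off f_C1 f_sym f'_lt0 a0 b1 x0ab q01 q_cvg d0 e0.
apply: filterS => n H t t01 td.
by rewrite mulrA ler_pdivrMr//; exact: H.
Qed.

Let kappa_off_ab (delta eta : R) : 0 < delta -> 0 < eta ->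
  \forall n \near \oo, forall t, a <= t <= b -> delta <= `|t - x0| ->
  n%:R * kappa n t <= eta.
Proof.
move=> d0 e0; apply: filterS (kappa_off d0 e0) => n H t /sub01; exact: H.
Qed.

Let cg : {in `[a, b], continuous (curvature f)}.
Proof.
by move=> t; rewrite in_itv/= => /sub01; exact: curvature_continuous.
Qed.

Let g_gt0 t : a <= t <= b -> 0 < curvature f t.
Proof. by move=> /sub01; exact: curvature_gt0. Qed.

Let cp : {in `[a, b], continuous p}.
Proof. by move=> t; rewrite in_itv/= => /sub01; case: nu_prior => _ + _; apply. Qed.

Let p0 (t : R) : 0 < t < 1 -> 0 <= p t. Proof. by case: nu_prior => + _ _; apply. Qed.

Let cont_meas (h : R -> R) : (forall t : R, 0 < t < 1 -> {for t, continuous h}) ->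
  measurable_fun (`]0, 1[ : set (measurableTypeR R)) h.
Proof.
move=> ch; apply: open_continuous_measurable_fun; first exact: interval_open.
by move=> x; rewrite inE/= in_itv/=; exact: ch.
Qed.

Let prior_01 : nu `]0%R, 1%R[%classic = 1%E.
Proof. by case: nu_prior => _ _; exact: has_density_01_mass. Qed.

Let weight_le1 n (t : R) : 0 < t < 1 -> gibbs_weight f n (q n) t <= 1.
Proof.
move=> t01; rewrite -expR0 ler_expR mulNr oppr_le0.
have t01' : 0 < 1 - t < 1.
  by case/andP: t01 => t0 t1; rewrite subr_gt0 t1 ltrBlDr ltrDl.
case/andP: (q01 n) => qn0 qn1.
by rewrite mulr_ge0// addr_ge0// mulr_ge0 ?f_ge0// subr_ge0.
Qed.

Let tq (n : nat) (t : R) : 0 < t < 1 -> `|t - q n| <= 1.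
Proof.
move=> /andP[t0 t1]; case/andP: (q01 n) => qn0 qn1.
by rewrite ler_norml; lra.
Qed.

(** An unnormalized posterior moment: dividing by the mass S of the weight on the
    segment, instead of the integral against nu, leaves the ratios unchanged and
    gives [posterior_moment] a finite nonzero limit in degree 0. *)
Definition posterior_moment (j n : nat) : R :=
  \int[nu]_(t in `]0, 1[) (rescaled q n t ^+ j * kappa n t).

Let zk j n t := rescaled q n t ^+ j * kappa n t.

Let czk j n (t : R) : 0 < t < 1 -> {for t, continuous (zk j n)}.
Proof.
move=> t01; apply: cvgM; last exact: ckappa.
apply: (@cvg_comp _ _ _ (rescaled q n) (fun x => x ^+ j)); last first.
  exact: exprn_continuous.
by apply: cvgM; [exact: cvg_cst|apply: cvgB => //; exact: cvg_cst].
Qed.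

(* On the segment nu has density p; off the segment |z|^j kappa <= n kappa for
   j <= 2, which tends to 0 uniformly, and nu is a probability. *)
Let posterior_moment_cvg j (l : R) : (j <= 2)%N ->
  (\int[mu]_(t in `[a, b]) (p t * zk j n t) @[n --> \oo] --> l) ->
  posterior_moment j n @[n --> \oo] --> l.
Proof.
move=> j2 zkl.
pose I : set (measurableTypeR R) := `]0%R, 1%R[%classic.
pose J : set (measurableTypeR R) := `[a, b]%classic.
have mI : measurable I by exact: measurable_itv.
have mJ : measurable J by exact: measurable_itv.
have JI : J `<=` I by move=> t; rewrite /J /I /= !in_itv/=; exact: sub01.
have rz n t : 0 < t < 1 -> `|rescaled q n t| <= Num.sqrt n%:R.
  move=> t01; rewrite normrM ger0_norm ?sqrtr_ge0//.
  by rewrite ler_piMr ?sqrtr_ge0// tq.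
have izk n : nu.-integrable I (EFin \o zk j n).
  apply: (@integrable_01 _ _ (Num.sqrt n%:R ^+ j * (S n)^-1)).
    by apply: cont_meas => t; exact: czk.
  move=> t t01; rewrite normrM (ger0_norm (kappa_ge0 _ _)).
  rewrite ler_pM// ?normrX ?exprn_ge0//.
    by rewrite lerXn2r ?nnegrE ?sqrtr_ge0// rz.
  by rewrite ler_piMl ?invr_ge0 ?(ltW (S0 n))// weight_le1.
have zkJ n : \int[nu]_(t in J) zk j n t = \int[mu]_(t in `[a, b]) (p t * zk j n t).
  rewrite /Rintegral (@integral_has_density_01 _ mu nu p)//.
  - by under eq_integral do rewrite mulrC.
  - by case: nu_prior.
  - by apply: cont_meas; case: nu_prior.
  - exact: (integrableS mI mJ JI).
have tail : \int[nu]_(t in I `\` J) zk j n t @[n --> \oo] --> 0.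
  apply/cvgr0Pnorm_le => e e0; case/andP: x0ab => ax xb.
  have d0 : 0 < Num.min (x0 - a) (b - x0) by rewrite lt_min !subr_gt0 ax.
  near=> n.
  have n0 : (0 < n)%N by near: n; exact: nbhs_infty_gt.
  have n1 : (1 : R) <= n%:R by rewrite ler1n.
  have s1 : (1 : R) <= Num.sqrt n%:R by rewrite -[leLHS]sqrtr1 ler_wsqrtr.
  have sj : Num.sqrt n%:R ^+ j <= n%:R :> R.
    by rewrite -[leRHS]sqr_sqrtr// ler_weXn2l.
  have zke t : (I `\` J) t -> `|zk j n t| <= e.
    rewrite /I /J /= !in_itv/= => -[t01 tJ].
    rewrite normrM (ger0_norm (kappa_ge0 _ _)).
    apply: (@le_trans _ _ (n%:R * kappa n t)).
      rewrite ler_wpM2r// normrX (le_trans _ sj)//.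
      by rewrite lerXn2r ?nnegrE ?sqrtr_ge0// rz.
    have : Num.min (x0 - a) (b - x0) <= `|t - x0|.
      move/negP: tJ; rewrite negb_and -!ltNge ge_min => /orP[ta|bt].
        have tx : t - x0 < 0 by rewrite subr_lt0 (lt_trans ta).
        by rewrite ltr0_norm// opprB lerD2l lerN2 ltW.
      have tx : 0 < t - x0 by rewrite subr_gt0 (lt_trans xb).
      by rewrite gtr0_norm// lerD2r (ltW bt) orbT.
    by move: t {tJ} t01; near: n; exact: kappa_off.
  have mIJ : measurable (I `\` J) by exact: measurableD.
  have izkIJ : nu.-integrable (I `\` J) (EFin \o zk j n).
    by apply: (@integrableS _ _ _ _ I) => //; exact: subDsetl.
  rewrite (le_trans (le_normr_Rintegral mIJ izkIJ))//.
  apply: (@le_trans _ _ (\int[nu]_(t in I `\` J) e)).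
    apply: le_Rintegral => //; first exact: integrable_norm.
    apply: (@integrable_bounded _ _ _ _ _ `|e|) => //.
    by rewrite ltey_eq fin_num_measure.
  rewrite Rintegral_cst// ler_piMr ?(ltW e0)// -lee_fin fineK ?fin_num_measure//.
  exact: probability_le1.
rewrite -[l]addr0.
have E n : posterior_moment j n =
    \int[mu]_(t in `[a, b]) (p t * zk j n t) + \int[nu]_(t in I `\` J) zk j n t.
  rewrite -zkJ -Rintegral_setU//.
  - by rewrite setDUK.
  - exact: measurableD.
  - by rewrite setDUK.
  - by apply/disj_setPS => t [? []].
under eq_cvg do rewrite E.
exact: cvgD.
Unshelve. all: by end_near. Qed.


Let a_ge0 : 0 <= a. Proof. exact: ltW. Qed.
Let b_le1 : b <= 1. Proof. exact: ltW. Qed.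

Lemma posterior_moment0_cvg : posterior_moment 0%N n @[n --> \oo] --> p x0.
Proof.
apply: posterior_moment_cvg => //; under eq_cvg do under eq_Rintegral do
  rewrite /zk expr0 mul1r.
exact: (@laplace_moment0 R a b x0 (curvature f) q).
Qed.

Lemma posterior_moment1_cvg : posterior_moment 1%N n @[n --> \oo] --> 0.
Proof.
apply: posterior_moment_cvg => //; under eq_cvg do under eq_Rintegral do
  rewrite /zk expr1.
exact: (@laplace_moment1 R a b x0 (curvature f) q).
Qed.

Lemma posterior_moment2_cvg :
  posterior_moment 2%N n @[n --> \oo] --> p x0 / curvature f x0.
Proof.
apply: posterior_moment_cvg => //.
exact: (@laplace_moment2 R a b x0 (curvature f) q).
Qed.

Let posterior n := gibbs_posterior f nu n (q n).

Let posterior_density n :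
  has_density_01 nu (gibbs_density f nu n (q n)) (posterior n).
Proof.
by apply: gibbs_posteriorP => //; exact: C1_01_measurable.
Qed.

Let Z n := \int[nu]_(t in `]0, 1[) gibbs_weight f n (q n) t.

Let posterior_01 n : posterior n `]0%R, 1%R[%classic = 1%E.
Proof. exact: has_density_01_mass (@posterior_density n). Qed.

Lemma posterior_momentE j n : Num.sqrt n%:R ^+ j *
    \int[posterior n]_(t in `]0, 1[) (t - q n) ^+ j =
  posterior_moment j n / posterior_moment 0%N n.
Proof.
have mI : measurable (`]0%R, 1%R[%classic : set (measurableTypeR R)).
  exact: measurable_itv.
have ctq (t : R) : {for t, continuous (fun t => (t - q n) ^+ j)}.
  apply: (@cvg_comp _ _ _ (fun t => t - q n) (fun x => x ^+ j)); last first.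
    exact: exprn_continuous.
  by apply: cvgB => //; exact: cvg_cst.
have nuint (h : R -> R) : (forall t : R, 0 < t < 1 -> {for t, continuous h}) ->
    (forall t : R, 0 < t < 1 -> `|h t| <= 1) ->
    nu.-integrable `]0%R, 1%R[%classic (EFin \o h).
  by move=> ch h1; apply: (@integrable_01 _ _ 1) => //; exact: cont_meas.
have tqj t : 0 < t < 1 -> `|(t - q n) ^+ j| <= 1.
  by move=> t01; rewrite normrX exprn_ile1// tq.
have w1 t : 0 < t < 1 -> `|gibbs_weight f n (q n) t| <= 1.
  by move=> t01; rewrite ger0_norm ?expR_ge0// weight_le1.
have cw (t : R) : 0 < t < 1 -> {for t, continuous (gibbs_weight f n (q n))}.
  exact: gibbs_weight_continuous.
pose m := \int[nu]_(t in `]0, 1[) ((t - q n) ^+ j * gibbs_weight f n (q n) t).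
have im : nu.-integrable `]0%R, 1%R[%classic
    (EFin \o (fun t => (t - q n) ^+ j * gibbs_weight f n (q n) t)).
  apply: nuint => t t01; first by apply: cvgM; [exact: ctq|exact: cw].
  by rewrite normrM mulr_ile1// ?tqj ?w1.
have -> : \int[posterior n]_(t in `]0, 1[) (t - q n) ^+ j = m / Z n.
  rewrite /Rintegral (integral_has_density_01 (@posterior_density n))//.
  - rewrite -[RHS]RintegralZr//; congr fine; apply: eq_integral => t _.
    by rewrite /gibbs_density mulrA.
  - by apply: cont_meas => t t01; apply: cvgM; [exact: cw|exact: cvg_cst].
  - move=> t t01; rewrite divr_ge0 ?expR_ge0//.
    by apply: Rintegral_ge0 => ? _; exact: expR_ge0.
  - apply: (@integrable_01 _ _ 1); last by move=> t; exact: tqj.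
    by apply: cont_meas => t _; exact: ctq.
have -> : posterior_moment j n = Num.sqrt n%:R ^+ j / S n * m.
  rewrite /posterior_moment /m -RintegralZl//.
  by apply: eq_Rintegral => t _; rewrite /rescaled exprMn /kappa; ring.
have -> : posterior_moment 0%N n = Z n / S n.
  rewrite /posterior_moment /Z -RintegralZr//; last exact: nuint.
  by apply: eq_Rintegral => t _; rewrite expr0 mul1r.
rewrite invf_div; move: (S n) (S0 n) (Z n) => s s0 y.
rewrite (_ : _ / s * m * (s / y) = Num.sqrt n%:R ^+ j * (m / y) * (s / s)).
  by rewrite divff ?gt_eqF// mulr1.
by ring.
Qed.

(** n V = m2 / m0 - (m1 / m0)^2, which tends to
    (p / g) / p - (0 / p)^2 = 1 / g at x0. *)
Lemma gibbs_posterior_variance_cvg : 0 < p x0 ->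
  (n%:R%:E * 'V_(gibbs_posterior f nu n (q n))
    [idfun : measurableTypeR R -> R])%E @[n --> \oo]
  --> ((curvature f x0)^-1)%:E.
Proof.
move=> px0.
have E n : (n%:R%:E * 'V_(gibbs_posterior f nu n (q n))
    [idfun : measurableTypeR R -> R])%E =
    (posterior_moment 2%N n / posterior_moment 0%N n -
     (posterior_moment 1%N n / posterior_moment 0%N n) ^+ 2)%:E.
  rewrite (variance_01 (@posterior_01 n) (q n)) -EFinM; congr EFin.
  rewrite -!posterior_momentE sqr_sqrtr//.
  by rewrite expr1 exprMn sqr_sqrtr// -mulrBr.
under eq_cvg do rewrite E.
apply: cvg_EFin; first exact: nearW.
have g0 : 0 < curvature f x0 by exact: curvature_gt0.
have -> : (curvature f x0)^-1 =
    p x0 / curvature f x0 / p x0 - (0 / p x0) ^+ 2.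
  by field; rewrite !gt_eqF.
have cV : (posterior_moment 0%N n)^-1 @[n --> \oo] --> (p x0)^-1.
  by apply: cvgV posterior_moment0_cvg; rewrite gt_eqF.
apply: cvgB; first exact: cvgM posterior_moment2_cvg cV.
by rewrite expr2; apply: cvgM; exact: cvgM posterior_moment1_cvg cV.
Qed.

End posterior_moments.

(** * The limit of the posterior variance *)

Theorem proposition3 (R : realType) (d : measure_display)
  (Omega : measurableType d) (P : probability Omega R)
  (theta0 : R) (theta0_01 : 0 < theta0 < 1)
  (X : nat -> {RV P >-> R}) (iidX : iid_bernoulli theta0 X)
  (f : R -> R)
  (f_ge0 : forall x : R, 0 < x < 1 -> 0 <= f x)
  (f_C1 : C1_01 f)
  (f_sym : forall x : R, 0 < x < 1 ->
     x * f^`()%classic x = (1 - x) * f^`()%classic (1 - x))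
  (f'_lt0 : forall x : R, 0 < x < 1 -> f^`()%classic x < 0)
  (nu : probability (measurableTypeR R) R) (p : R -> R)
  (nu_prior : is_prior nu p)
  (nu_theta0 : forall eta : R, 0 < eta ->
     (0 < nu `](theta0 - eta)%R, (theta0 + eta)%R[%classic)%E)
  (p_theta0 : 0 < p theta0) :
  {ae P, forall w : Omega,
    (n%:R%:E * 'V_(gibbs_posterior f nu n
                     (empirical_freq (fun i => X i : Omega -> R) n w))
                 [idfun : measurableTypeR R -> R])%E @[n --> \oo]
    --> (- (theta0 * (1 - theta0) / (theta0 * f^`()%classic theta0)))%:E}.
Proof.
apply: filterS (bernoulli_slln iidX) => w qw.
have f't : f^`()%classic theta0 < 0 by exact: f'_lt0.
case/andP: (theta0_01) => t0 t1.
have -> : - (theta0 * (1 - theta0) / (theta0 * f^`()%classic theta0)) =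
    (curvature f theta0)^-1.
  have f'_neq0 : f^`()%classic theta0 != 0 by rewrite lt_eqF.
  have theta0_neq0 : theta0 != 0 by rewrite gt_eqF.
  have theta1_neq0 : 1 - theta0 != 0 by rewrite gt_eqF// subr_gt0.
  by rewrite /curvature; field; apply/and3P.
apply: (gibbs_posterior_variance_cvg theta0_01 f_ge0 f_C1 f_sym f'_lt0 nu_prior
  _ qw p_theta0) => n.
have Xge0 i : 0 <= X i w by case: iidX => /(_ i w)[->|->].
have Xle1 i : X i w <= 1 by case: iidX => /(_ i w)[->|->].
rewrite /empirical_freq divr_ge0 ?sumr_ge0//=.
(* For n = 0 the frequency is 0 / 0 = 0. *)
have [->|n0] := posnP n; first by rewrite invr0 mulr0.
rewrite ler_pdivrMr ?ltr0n// mul1r -[in leRHS](card_ord n) -sumr_const.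
exact: ler_sum.
Qed.
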